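(* Let $\lambda=(\lambda_1,\dots,\lambda_g)$ be the partition of a gap sequence of genus $g$, and let $\tau(t)=s_\lambda(t)+\sum_{\lambda<\mu}\xi_\mu s_\mu(t)$ with arbitrary $\xi_\mu\in\mathbb C$. (i) For $0\le k\le g$, $\partial_{a^{(k)}_1}\cdots\partial_{a^{(k)}_{m_k}}\tau\big(\sum_{i=1}^k[x_i]\big)=c_k\,\tau^{(k)}\big(\sum_{i=1}^k[x_i]\big)$. (ii) For $1\le k\le g$, $\tau^{(k)}\big(\sum_{i=1}^k[x_i]\big)=\tau^{(k-1)}\big(\sum_{i=1}^{k-1}[x_i]\big)x_k^{\lambda_k}+O(x_k^{\lambda_k+1})$.
   Context: For $t=(t_1,t_2,\dots)$ define $p_m(t)$ by $\exp(\sum_{m\ge1}t_mk^m)=\sum_{m\ge0}p_m(t)k^m$, $p_m=0$ for $m<0$; $s_\mu(t)=\det(p_{\mu_i-i+j}(t))_{1\le i,j\le l}$ for a partition $\mu=(\mu_1\ge\dots\ge\mu_l)$ (partitions are identified up to trailing zeros). $[x]=(x,x^2/2,\dots)$, $\partial_i=\partial/\partial t_i$. Partial order: $\lambda\le\mu$ iff $\lambda_i\le\mu_i$ for all $i$; $\lambda<\mu$ means $\lambda\le\mu$, $\lambda\ne\mu$. $\tau$ is understood as a formal series, differentiated termwise, its evaluations at $t=\sum[x_i]$ being formal power series in the $x_i$. For $1\le k\le l$ (here $l=g$), $\tau^{(k)}(t)=s_{(\lambda_1,\dots,\lambda_k)}(t)+\sum_\mu\xi_\mu s_{(\mu_1,\dots,\mu_k)}(t)$,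 summed over partitions $\mu=(\mu_1,\dots,\mu_l)$ with $\lambda<\mu$ and $\mu_i=\lambda_i$ for $k+1\le i\le l$; $\tau^{(0)}=1$. Gap sequence of genus $g$: $G\subset\mathbb Z_{\ge0}$, $\#G=g\ge1$, complement $G^c$ containing $0$ and closed under addition; $G=\{w_1<\dots<w_g\}$, $G^c=\{0=w_1^*<w_2^*<\cdots\}$, $\lambda=(w_g,\dots,w_1)-(g-1,\dots,0)$. For $0\le k\le g-1$: $m_k=\#\{i:w_i^*<g-k\}$, $a^{(k)}_j=w_{g-k-j+1}-w_j^*$ ($1\le j\le m_k$), and $c_k$ is the sign of the permutation sending $(w_1^*,\dots,w_{m_k}^*,w_{g-k-m_k},\dots,w_1)$ to $(g-k-1,\dots,1,0)$; for $k=g$ the derivative product is the identity and $c_g=1$. For $k=0$ evaluation is at $t=0$. *)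

(* Defs.v *)
From HB Require Import structures.
From mathcomp Require Import all_boot all_order all_algebra.
From mathcomp Require Import mpoly.

Set Implicit Arguments.
Unset Strict Implicit.
Unset Printing Implicit Defensive.

Import Order.TTheory GRing.Theory Num.Theory.
Local Open Scope ring_scope.

(* Partitions are represented as seq nat, weakly decreasing, with all  *)
(* parts positive (so "up to trailing zeros" is just equality of seqs). *)
Definition is_partition (s : seq nat) : bool :=
  sorted (fun x y : nat => (y <= x)%N) s && all (fun x => (0 < x)%N) s.

(* lambda <= mu  iff  lambda_i <= mu_i for all i (entries beyond the   *)
(* size are 0, so it suffices to check i < size lambda).               *)
Definition ple (l m : seq nat) : bool :=
  all (fun i => (nth 0 l i <= nth 0 m i)%N) (iota 0 (size l)).
Definition plt (l m : seq nat) : bool := ple l m && (l != m).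

Definition psize (s : seq nat) : nat := (\sum_(x <- s) x)%N.

(* Finite enumeration of all partitions of weight < B: each such       *)
(* partition is the list of nonzero values of a unique weakly          *)
(* decreasing f : 'I_B -> 'I_B with total sum < B.                    *)
Definition part_of (B : nat) (f : {ffun 'I_B -> 'I_B}) : seq nat :=
  [seq (nat_of_ord (f i)) | i <- enum 'I_B & (0 < f i)%N].
Definition canon (B : nat) (f : {ffun 'I_B -> 'I_B}) : bool :=
  [forall i : 'I_B, forall j : 'I_B, ((i <= j)%N ==> (f j <= f i)%N)]
  && ((\sum_(i < B) (nat_of_ord (f i)))%N < B)%N.

Definition is_gap_seq (g : nat) (w : seq nat) : Prop :=
  [/\ (1 <= g)%N, size w = g, sorted ltn w, 0%N \notin w &
      forall a b : nat, a \notin w -> b \notin w -> (a + b)%N \notin w].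

Definition gap_lambda (g : nat) (w : seq nat) : seq nat :=
  [seq (nth 0 w (g - i.+1) - (g - i.+1))%N | i <- iota 0 g].

Definition nongaps_below (w : seq nat) (b : nat) : seq nat :=
  [seq x <- iota 0 b | x \notin w].

Definition mk (g : nat) (w : seq nat) (k : nat) : nat :=
  size (nongaps_below w (g - k)).

Definition a_seq (g : nat) (w : seq nat) (k : nat) : seq nat :=
  [seq (nth 0 w (g - k - j.+1) - nth 0 (nongaps_below w (g - k)) j)%N
  | j <- iota 0 (mk g w k)].

Definition c_source (g : nat) (w : seq nat) (k : nat) : seq nat :=
  nongaps_below w (g - k) ++ rev (take (g - k - mk g w k) w).

(* The permutation pi sending S to (n-1, ..., 1, 0) (n = g-k) puts the *)
(* entry S_i in position n-1-S_i; its sign is (-1)^(#inversions), the *)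
(* inversions being the pairs i<j with n-1-S_i > n-1-S_j, i.e. S_i<S_j. *)
Definition c_sign (C : ringType) (g : nat) (w : seq nat) (k : nat) : C :=
  let S := c_source g w k in
  (-1) ^+ (\sum_(i < size S) \sum_(j < size S)
             ((i < j)%N && (nth 0 S i < nth 0 S j)%N : nat))%N.

(* Polynomials in t_1, ..., t_N : variable 'X_j (j : 'I_N) is t_{j+1}. *)
Section Schur.
Variables (C : fieldType) (N : nat).

Definition tgen : {poly {mpoly C[N]}} :=
  \sum_(j < N) ('X_j)%:P * 'X^(j.+1).

(* p_m(t) = [k^m] exp(sum_j t_j k^j) = sum_{n<=m} [k^m] (sum t_j k^j)^n / n! *)
(* (terms n > m do not contribute); exact for m <= N.                 *)
Definition pt (m : nat) : {mpoly C[N]} :=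
  \sum_(n < m.+1) ((n`!)%:R^-1 : C) *: (tgen ^+ n)`_m.

Definition ptz (z : int) : {mpoly C[N]} :=
  match z with Posz m => pt m | Negz _ => 0 end.

Definition schur (mu : seq nat) : {mpoly C[N]} :=
  \det (\matrix_(i < size mu, j < size mu)
          ptz ((nth 0 mu i)%:Z - i%:Z + j%:Z)).

(* partial derivative d/dt_a (zero if t_a is not among t_1..t_N) *)
Definition dt (a : nat) (P : {mpoly C[N]}) : {mpoly C[N]} :=
  if (0 < a)%N then
    odflt 0 (omap (fun i : 'I_N => mderiv i P) (insub a.-1))
  else 0.

Definition dts (s : seq nat) (P : {mpoly C[N]}) : {mpoly C[N]} :=
  foldr dt P s.

(* evaluation at t = [x_1] + ... + [x_r], the x_i being the first r   *)
(* variables of {mpoly C[n]} :  t_j |-> sum_{i<r} x_i^j / j           *)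
Definition evx (n r : nat) (P : {mpoly C[N]}) : {mpoly C[n]} :=
  mmap (@mpolyC _ C)
    (fun j : 'I_N => ((j.+1)%:R^-1 : C) *:
        \sum_(i < n | (i < r)%N) 'X_i ^+ j.+1) P.
End Schur.

(* Partial sums of tau and tau^{(k)} over partitions of weight < B,   *)
(* as polynomials in t_1..t_B.                                         *)
Definition tau_part (C : fieldType) (lam : seq nat) (xi : seq nat -> C)
    (B : nat) : {mpoly C[B]} :=
  schur C B lam +
  \sum_(f : {ffun 'I_B -> 'I_B} | canon f && plt lam (part_of f))
     xi (part_of f) *: schur C B (part_of f).

Definition tauk_part (C : fieldType) (g : nat) (lam : seq nat)
    (xi : seq nat -> C) (k B : nat) : {mpoly C[B]} :=
  if k == 0%N then 1 else
  schur C B (take k lam) +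
  \sum_(f : {ffun 'I_B -> 'I_B} |
          [&& canon f, plt lam (part_of f), (size (part_of f) <= g)%N &
           all (fun i => nth 0 (part_of f) i == nth 0 lam i) (iota k (g - k))])
     xi (part_of f) *: schur C B (take k (part_of f)).

(* Main.v *)
(* Write [d_i = mu_i - i], so that [s_mu = det (p_(d_i + j))].  Since
   [dp_m/dt_a = p_(m-a)], the iterated derivative of [s_mu] is the sum, over all
   ways of distributing the [a_j] among the rows, of the determinants with
   lowered [d_i].  At [sum_(i<k) [x_i]] such a determinant vanishes unless every
   [-j] with [j >= k] is among the lowered [d_i]; comparing sums, and using
   [sum_j a_j = sum_(i>=k) lambda_i], this forces [mu_i = lambda_i] for
   [i >= k] and confines the subtractions to the rows [i >= k].  Each [a_j] is
   a gap minus a nongap, paired so that only one distribution fills the missing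
   nongaps; its determinant is block triangular, with blocks
   [s_(mu_0, ..., mu_(k-1))] and a permutation matrix, whence the sign.  For
   (ii), a column operation makes the last column of [s_nu(x_0, ..., x_k)] equal
   to [x_k ^ (nu_i - i + k)], and one expands along it. *)
Require Import Defs.
From HB Require Import structures.
From mathcomp Require Import all_boot all_order all_algebra.
From mathcomp Require Import mpoly perm ring zify.
Import Order.TTheory GRing.Theory Num.Theory.
Local Open Scope ring_scope.
Set Implicit Arguments.
Unset Strict Implicit.
Unset Printing Implicit Defensive.

(** * The generating series and the derivatives of the [p_m] *)

Section GeneratingFunction.
Variables (C : numFieldType) (N : nat).
Local Notation T := (tgen C N).

Definition exp_trunc (L : nat) : {poly {mpoly C[N]}} :=
  \sum_(n < L) ((n`!)%:R^-1 : C)%:MP *: T ^+ n.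

Lemma tgenE : T = (\sum_(j < N) ('X_j)%:P * 'X^j) * 'X.
Proof.
by rewrite mulr_suml; apply: eq_bigr => j _; rewrite exprSr mulrA.
Qed.

Lemma coef_tgenX_small n m : (m < n)%N -> (T ^+ n)`_m = 0.
Proof. by move=> lt_mn; rewrite tgenE exprMn coefMXn lt_mn. Qed.

(** [T ^+ n] is divisible by ['X^n], so the terms cut off only affect degrees at least [L]. *)
Lemma coef_exp_trunc L m : (m < L)%N -> (exp_trunc L)`_m = pt C N m.
Proof.
move=> lt_mL; rewrite /exp_trunc coef_sum /pt.
rewrite (big_ord_widen L (fun n => ((n`!)%:R^-1 : C) *: (T ^+ n)`_m) lt_mL).
rewrite [RHS]big_mkcond; apply: eq_bigr => n _.
rewrite coefZ mul_mpolyC ltnS; case: leqP => // lt_mn.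
by rewrite coef_tgenX_small // scaler0.
Qed.

Lemma invr_factS n : ((n.+1)`!%:R^-1 : C) *+ n.+1 = n`!%:R^-1.
Proof.
rewrite factS natrM invfM -mulrnAl -mulr_natr mulVf ?mul1r //.
by rewrite pnatr_eq0.
Qed.

Lemma deriv_exp_trunc L : (exp_trunc L.+1)^`() = T^`() * exp_trunc L.
Proof.
rewrite /exp_trunc big_ord_recl expr0 derivD derivZ derivC scaler0 add0r.
rewrite raddf_sum mulr_sumr; apply: eq_bigr => n _.
rewrite /= derivZ [bump 0 n]add1n deriv_exp -scalerMnr scalerMnl -mpolyCMn.
by rewrite invr_factS scalerAr.
Qed.

(** The derivation [d/dt_(i+1)], extended to polynomials in ['X] with ['X] treated as a constant. *)
Definition coef_mderiv (i : 'I_N) (P : {poly {mpoly C[N]}}) :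
    {poly {mpoly C[N]}} := \poly_(m < size P) mderiv i P`_m.

Lemma coef_coef_mderiv i P m : (coef_mderiv i P)`_m = mderiv i P`_m.
Proof.
by rewrite coef_poly; case: ltnP => // leP; rewrite nth_default // mderiv0.
Qed.

Lemma coef_mderivM i P Q :
  coef_mderiv i (P * Q) = coef_mderiv i P * Q + P * coef_mderiv i Q.
Proof.
apply/polyP=> m; rewrite coef_coef_mderiv coefD !coefM linear_sum -big_split /=.
by apply: eq_bigr => j _; rewrite mderivM !coef_coef_mderiv.
Qed.

Lemma coef_mderivX i P n :
  coef_mderiv i (P ^+ n) = (coef_mderiv i P * P ^+ n.-1) *+ n.
Proof.
elim: n => [|n IHn].
  apply/polyP=> m; rewrite coef_coef_mderiv expr0 mulr0n [RHS]coef0 coef1.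
  by rewrite -mpolyC_nat mderivC.
rewrite exprS coef_mderivM IHn /=; case: n {IHn} => [|n] /=.
  by rewrite mulr0n mulr0 addr0 expr0 mulr1 mulr1n.
by rewrite exprS mulrnAr mulrCA [RHS]mulrS.
Qed.

Lemma coef_mderiv_tgen i : coef_mderiv i T = 'X^(i.+1).
Proof.
apply/polyP=> m; rewrite coef_coef_mderiv /tgen coef_sum linear_sum /=.
rewrite (bigD1 i) //= big1 => [|j neq_ji].
  rewrite addr0 coefCM coefXn; case: (m == i.+1); rewrite ?mulr1 ?mulr0 ?mderiv0 //.
  by rewrite mderivX mnm1E eqxx scale1r -[X in (X - _)%MM]add0m addmK mpolyX0.
rewrite coefCM coefXn; case: (m == j.+1); rewrite ?mulr1 ?mulr0 ?mderiv0 //.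
by rewrite mderivX mnm1E (negPf neq_ji) scale0r.
Qed.

(** [d/dt_a] multiplies the generating series [exp(T)] by ['X^a]; compare coefficients. *)
Lemma dt_pt (a m : nat) : (0 < a)%N -> (a <= N)%N ->
  dt a (pt C N m) = if (a <= m)%N then pt C N (m - a) else 0.
Proof.
case: a => // a _ lt_aN; rewrite /dt /= insubT /=; set i := Sub a lt_aN.
(* One term more than degree [m] requires, because differentiation kills the constant term. *)
rewrite -(@coef_exp_trunc m.+2) // -coef_coef_mderiv.
have -> : coef_mderiv i (exp_trunc m.+2) = 'X^(a.+1) * exp_trunc m.+1.
  apply/polyP=> q; rewrite coef_coef_mderiv /exp_trunc coef_sum linear_sum /=.
  rewrite big_ord_recl expr0 coefZ mul_mpolyC linearZ /= -coef_coef_mderiv.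
  rewrite -(expr0 T) coef_mderivX mulr0n coef0 scaler0 add0r.
  rewrite mulr_sumr coef_sum; apply: eq_bigr => n _.
  rewrite [bump 0 n]add1n coefZ mul_mpolyC linearZ /= -coef_coef_mderiv coef_mderivX /=.
  rewrite coef_mderiv_tgen coefMn -scalerMnr scalerMnl invr_factS.
  by rewrite -scalerAr coefZ mul_mpolyC.
rewrite coefXnM ltnS; case: ltnP => // le_am.
by rewrite coef_exp_trunc // ltnS leq_subr.
Qed.

End GeneratingFunction.

(** * The polynomial [E = prod (1 - x 'X)] and its inverse series *)

Section ElementaryPolynomial.
Variable R : comNzRingType.

Definition elem_poly (xs : seq R) : {poly R} := \prod_(x <- xs) (1 - x%:P * 'X).

Lemma elem_poly_cons x xs :
  elem_poly (x :: xs) = (1 - x%:P * 'X) * elem_poly xs.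
Proof. by rewrite /elem_poly big_cons. Qed.

Lemma elem_poly_rcons xs x :
  elem_poly (rcons xs x) = elem_poly xs * (1 - x%:P * 'X).
Proof. by rewrite /elem_poly -cats1 big_cat big_seq1. Qed.

Lemma size_elem_poly xs : (size (elem_poly xs) <= (size xs).+1)%N.
Proof.
elim: xs => [|x xs IHxs]; first by rewrite /elem_poly big_nil size_poly1.
rewrite elem_poly_cons (leq_trans (size_polyMleq _ _)) //.
have : (size (1 - x%:P * 'X)%R <= 2)%N.
  rewrite (leq_trans (size_polyD _ _)) // geq_max size_poly1 size_polyN /=.
  by rewrite mul_polyC (leq_trans (size_scale_leq _ _)) // size_polyX.
by move=> le_size; have := leq_add le_size IHxs; case: (_ + _)%N.
Qed.

Lemma coef0_elem_poly xs : (elem_poly xs)`_0 = 1.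
Proof.
elim: xs => [|x xs IHxs]; first by rewrite /elem_poly big_nil coef1.
by rewrite elem_poly_cons coef0M IHxs coefB coef1 coefMX subr0 mulr1.
Qed.

Definition psum_poly (B : nat) (xs : seq R) : {poly R} :=
  \sum_(j < B) (\sum_(x <- xs) x ^+ j.+1)%:P * 'X^j.

(** The logarithmic derivative [- E' / E] is [sum_x x / (1 - x 'X)], the series of the power sums;
    cutting it at degree [B] leaves an error divisible by ['X^B]. *)
Lemma psum_elem_poly B xs :
  exists P, psum_poly B xs * elem_poly xs + (elem_poly xs)^`() = P * 'X^B.
Proof.
elim: xs => [|x xs [P IHxs]].
  exists 0; rewrite /psum_poly /elem_poly big_nil derivC addr0 mulr1 mul0r.
  by rewrite big1 // => j _; rewrite big_nil mul0r.
pose G B := \sum_(j < B) (x ^+ j.+1)%:P * 'X^j : {poly R}.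
have G_geom D : G D * (1 - x%:P * 'X) = x%:P - (x ^+ D.+1)%:P * 'X^D.
  elim: D => [|D IHD]; first by rewrite /G big_ord0 mul0r expr0 expr1 mulr1 subrr.
  rewrite /G big_ord_recr /= mulrDl IHD (exprS _ D.+1) (exprS _ D) (exprS 'X) !polyCM.
  ring.
have psum_cons : psum_poly B (x :: xs) = G B + psum_poly B xs.
  rewrite /psum_poly /G -big_split; apply: eq_bigr => j _ /=.
  by rewrite big_cons polyCD mulrDl.
exists ((1 - x%:P * 'X) * P - (x ^+ B.+1)%:P * elem_poly xs).
have -> : ((1 - x%:P * 'X) * P - (x ^+ B.+1)%:P * elem_poly xs) * 'X^B
  = (1 - x%:P * 'X) * (P * 'X^B) - (x ^+ B.+1)%:P * 'X^B * elem_poly xs by ring.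
rewrite -IHxs psum_cons elem_poly_cons derivM derivB derivM derivX derivC -polyC1.
rewrite derivC polyC1.
have -> : (x ^+ B.+1)%:P * 'X^B = x%:P - G B * (1 - x%:P * 'X).
  by rewrite G_geom; ring.
ring.
Qed.

(* Solving [H' = G H] for the power sums [G = - E'/E] gives [H = 1/E]. *)
Lemma elem_poly_inv B xs (H P : {poly R}) :
    (forall (x : R) n, x *+ n.+1 = 0 -> x = 0) ->
    H`_0 = 1 -> H^`() = psum_poly B xs * H + P * 'X^B ->
  forall m, (m <= B)%N -> (elem_poly xs * H)`_m = (m == 0%N)%:R.
Proof.
move=> char0 H0 derivH [|m] lt_mB.
  by rewrite coef0M coef0_elem_poly H0 mulr1.
have [P' EP'] := psum_elem_poly B xs.
(* [(E H)'] is divisible by ['X^B], and its coefficient of degree [m] is [m+1] times that of [E H]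
   in degree [m+1]. *)
apply: (char0 _ m); rewrite -coef_deriv derivM derivH.
have -> : (elem_poly xs)^`() * H + elem_poly xs * (psum_poly B xs * H + P * 'X^B)
  = (psum_poly B xs * elem_poly xs + (elem_poly xs)^`()) * H
    + elem_poly xs * P * 'X^B by ring.
by rewrite EP' mulrAC -mulrDl coefMXn lt_mB.
Qed.

(** If [H] inverts the full product, omitting the factor of [x] leaves the geometric series
    [1 / (1 - x 'X)]. This yields the pure powers of the last variable in (ii). *)
Lemma elem_poly_rcons_inv B xs x (H : {poly R}) :
    (forall m, (m <= B)%N -> (elem_poly (rcons xs x) * H)`_m = (m == 0%N)%:R) ->
  forall m, (m <= B)%N -> (elem_poly xs * H)`_m = x ^+ m.
Proof.
move=> invH; elim=> [|m IHm] le_mB.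
  by have := invH 0%N isT; rewrite !coef0M !coef0_elem_poly expr0.
have := invH _ le_mB; rewrite elem_poly_rcons mulrAC mulrBr mulr1 coefB.
rewrite mulrA [_ * x%:P]mulrC -mulrA coefCM coefMX /= IHm ?(ltnW le_mB) // => /eqP.
by rewrite subr_eq0 -exprS => /eqP.
Qed.

End ElementaryPolynomial.

(** * Evaluation at [t = sum_i [x_i]] *)

Section Evaluation.
Variables (C : numFieldType) (N n r : nat).
Local Notation ev := (@evx C N n r).

Definition first_vars : seq {mpoly C[n]} :=
  [seq 'X_i | i : 'I_n <- [seq j : 'I_n <- enum 'I_n | (j < r)%N]].

HB.instance Definition _ := GRing.RMorphism.copy ev
  (mmap (@mpolyC n C) (fun j : 'I_N => ((j.+1)%:R^-1 : C) *:
        \sum_(i < n | (i < r)%N) 'X_i ^+ j.+1)).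

Lemma evxZ c P : ev (c *: P) = c *: ev P.
Proof. by rewrite /evx mmapZ mul_mpolyC. Qed.

Lemma evxD P Q : ev (P + Q) = ev P + ev Q.
Proof. exact: rmorphD. Qed.

Lemma evx_sum (I : Type) (s : seq I) (p : pred I) (F : I -> {mpoly C[N]}) :
  ev (\sum_(i <- s | p i) F i) = \sum_(i <- s | p i) ev (F i).
Proof. exact: rmorph_sum. Qed.

Lemma evxX i : ev 'X_i = ((i.+1)%:R^-1 : C) *: \sum_(x <- first_vars) x ^+ i.+1.
Proof.
by rewrite /evx mmapX mmap1U /first_vars big_map big_filter big_enum_cond.
Qed.

Lemma mpoly_mulrSn_eq0 (p : {mpoly C[n]}) m : p *+ m.+1 = 0 -> p = 0.
Proof.
move=> /(congr1 (fun q => (m.+1%:R^-1 : C) *: q)) /=.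
by rewrite -scalerMnr scalerMnl scaler0 -mulr_natr mulVf ?pnatr_eq0 // scale1r.
Qed.

Lemma pt0 : pt C N 0 = 1.
Proof. by rewrite /pt big_ord1 fact0 invr1 scale1r expr0 coef1. Qed.

(** The evaluated [p_m] are the complete symmetric polynomials: modulo ['X^N] their series solves
    [H' = G H], with [G] the series of the power sums. *)
Lemma elem_poly_evx m : (m <= N)%N ->
  (elem_poly first_vars * \poly_(i < N.+1) ev (pt C N i))`_m = (m == 0%N)%:R.
Proof.
pose H := map_poly ev (exp_trunc C N N.+1).
have -> : \poly_(i < N.+1) ev (pt C N i) = \poly_(i < N.+1) H`_i.
  apply/polyP=> i; rewrite coef_poly [RHS]coef_poly.
  case: (ltnP i N.+1) => [lt_iN|] //.
  by rewrite /H coef_map coef_exp_trunc.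
move=> le_mN.
suff <- : (elem_poly first_vars * H)`_m = (m == 0%N)%:R.
  rewrite !coefM; apply: eq_bigr => i _; rewrite coef_poly ifT //.
  by rewrite ltnS (leq_trans (leq_subr _ _)).
have [P EP] : exists P, H^`() = psum_poly N first_vars * H + P * 'X^N.
  pose cN : {mpoly C[n]} := ev ((N`!)%:R^-1 : C)%:MP.
  pose U : {poly {mpoly C[N]}} := \sum_(j < N) ('X_j)%:P * 'X^j.
  pose V := map_poly ev (tgen C N)^`().
  (* The derivative of [exp_trunc N.+1] is [T'] times [exp_trunc N]; the missing term [T ^ N / N!],
     with ['X^N] factored out, gives the error. *)
  exists (- V * (cN *: map_poly ev (U ^+ N))).
  have EV : V = psum_poly N first_vars.
    rewrite /V /tgen raddf_sum rmorph_sum /=; apply: eq_bigr => j _.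
    rewrite derivM derivC mul0r add0r derivXn /=.
    rewrite rmorphM rmorphMn /= map_polyC map_polyXn /= evxX.
    by rewrite mulrnAr -mulrnAl -polyCMn scalerMnl -mulr_natr mulVf ?pnatr_eq0 ?scale1r.
  rewrite -EV /H deriv_map deriv_exp_trunc rmorphM /= -/V.
  rewrite /exp_trunc [in RHS]big_ord_recr /= raddfD /= map_polyZ /=.
  rewrite tgenE exprMn rmorphM /= map_polyXn -/U -/cN.
  rewrite -!mul_polyC; ring.
apply: (elem_poly_inv mpoly_mulrSn_eq0 _ EP le_mN).
by rewrite /H coef_map coef_exp_trunc // pt0; apply: rmorph1.
Qed.
End Evaluation.

(** * Column operations on determinants with entries [h (d i + j)] *)

Section ColumnOperations.
Variables (R : comNzRingType) (h : nat -> R).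

Definition ext0 (z : int) : R := match z with Posz m => h m | Negz _ => 0 end.

(** The coefficient of degree [z] in [Q] times the series of the [h m]; [z] is an integer because
    [d i + j] may be negative. *)
Definition conv (Q : {poly R}) (z : int) : R :=
  \sum_(s < size Q) Q`_s * ext0 (z - s%:Z).

Lemma conv_neg Q z : z < 0 -> conv Q z = 0.
Proof.
move=> z_lt0; rewrite /conv big1 // => s _.
by case E: (z - s%:Z) => [m|m]; rewrite ?mulr0 //; lia.
Qed.

Lemma conv_nat B Q m : (m <= B)%N ->
  conv Q m%:Z = (Q * \poly_(i < B.+1) h i)`_m.
Proof.
move=> le_mB; rewrite /conv coefM.
pose F s := Q`_s * ext0 (m%:Z - s%:Z).
rewrite (big_ord_widen (maxn (size Q) m.+1) F) ?leq_maxl // big_mkcond /=.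
transitivity (\sum_(s < maxn (size Q) m.+1) F s).
  apply: eq_bigr => s _; case: ltnP => // le_s.
  by rewrite /F nth_default ?mul0r.
rewrite (big_ord_widen (maxn (size Q) m.+1)
  (fun s => Q`_s * (\poly_(i < B.+1) h i)`_(m - s))) ?leq_maxr //.
rewrite [RHS]big_mkcond; apply: eq_bigr => s _ /=; rewrite ltnS.
case: leqP => [le_sm|lt_ms]; rewrite /F; last first.
  case E: (m%:Z - s%:Z) => [q|q]; rewrite ?mulr0 //.
  by move: (nat_of_ord s) lt_ms E => s' ? ?; lia.
by rewrite coef_poly ltnS (leq_trans (leq_subr _ _)) // subzn.
Qed.

(** Right multiplication by the unitriangular [U] adds to each column [j >= k] earlier columns
    weighted by the coefficients of [Q]. *)
Lemma det_conv l k (Q : {poly R}) (d : 'I_l -> int) :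
    (size Q <= k.+1)%N -> Q`_0 = 1 ->
  \det (\matrix_(i < l, j < l) ext0 (d i + j%:Z)) =
  \det (\matrix_(i < l, j < l)
    if (j < k)%N then ext0 (d i + j%:Z) else conv Q (d i + j%:Z)).
Proof.
move=> szQ Q0.
pose U : 'M[R]_l := \matrix_(r, j)
  if (j < k)%N then (r == j)%:R else if (r <= j)%N then Q`_(j - r) else 0.
have detU : \det U = 1.
  rewrite -det_tr det_trig; last first.
    apply/is_trig_mxP=> i j lt_ij; rewrite !mxE (leqNgt j i) lt_ij /=.
    by case: ifP => // _; case: eqP lt_ij => // ->; rewrite ltnn.
  by rewrite big1 // => i _; rewrite !mxE eqxx leqnn subnn Q0 if_same.
rewrite -[LHS]mulr1 -detU -det_mulmx; congr (\det _); apply/matrixP=> i j.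
rewrite !mxE; case: ltnP => [lt_jk|le_kj].
  rewrite (bigD1 j) //= !mxE lt_jk eqxx mulr1 big1 ?addr0 // => r neq_rj.
  by rewrite !mxE lt_jk (negPf neq_rj) mulr0.
pose F (r : nat) := ext0 (d i + r%:Z) * Q`_(j - r).
transitivity (\sum_(r < l | (r < j.+1)%N) F r).
  rewrite [RHS]big_mkcond; apply: eq_bigr => r _.
  by rewrite !mxE ltnNge le_kj /= ltnS /F; case: ifP; rewrite ?mulr0.
rewrite -(big_ord_widen _ F) // (reindex_inj rev_ord_inj) /=.
pose G s := Q`_s * ext0 (d i + j%:Z - s%:Z).
(* Column [j - s] exists for every coefficient of [Q], since [size Q <= k+1 <= j+1]. *)
rewrite /conv (big_ord_widen j.+1 G) ?(leq_trans szQ) // [RHS]big_mkcond /=.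
apply: eq_bigr => s _; rewrite /F /G subSS.
have le_sj : (s <= j)%N by rewrite -ltnS.
rewrite subKn // mulrC -subzn // addrA; case: ltnP => // le_s.
by rewrite nth_default ?mul0r.
Qed.

End ColumnOperations.

(** * Signatures and inversions *)

Lemma det_vandermonde_nat n (f : 'I_n -> nat) :
  \det (Vandermonde n (\row_(i < n) (f i)%:R : 'rV[int]_n)) =
  \prod_(i < n) \prod_(j < n | (i < j)%N) ((f j)%:R - (f i)%:R).
Proof.
by rewrite det_Vandermonde; apply: eq_bigr => i _; apply: eq_bigr => j _; rewrite !mxE.
Qed.

(* Permuting the nodes [0, ..., n-1] of a Vandermonde determinant by [p]
   multiplies it by the signature, and flips one factor per inversion. *)
Lemma odd_perm_inversions n (p : 'S_n) :
  odd_perm p = odd (\sum_(i < n) \sum_(j < n) ((i < j)%N && (p j < p i)%N)).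
Proof.
pose V f : 'M[int]_n := Vandermonde n (\row_(i < n) (f i)%:R).
have detVp : \det (V (fun i => p i)) = (-1) ^+ p * \det (V (fun i => i)).
  have -> : V (fun i => p i) = col_perm p (V (fun i => i)).
    by apply/matrixP=> i j; rewrite !mxE.
  by rewrite col_permE det_mulmx det_perm odd_permV mulrC.
have sgV : Num.sg (\det (V (fun i => i))) = 1.
  rewrite gtr0_sg // det_vandermonde_nat; apply: prodr_gt0 => i _.
  by apply: prodr_gt0 => j lt_ij; rewrite subr_gt0 ltr_nat.
have sgVp : Num.sg (\det (V (fun i => p i))) =
    (-1) ^+ (\sum_(i < n) \sum_(j < n) ((i < j)%N && (p j < p i)%N)).
  rewrite det_vandermonde_nat (big_morph _ (@sgrM int) (sgr1 int)) -prodrXr.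
  apply: eq_bigr => i _; rewrite (big_morph _ (@sgrM int) (sgr1 int)) -prodrXr.
  rewrite big_mkcond; apply: eq_bigr => j _; case: ltnP => //= lt_ij.
  case: (ltngtP (p j) (p i)) => [lt_p|lt_p|eq_p].
  - by rewrite ltr0_sg ?expr1 // subr_lt0 ltr_nat.
  - by rewrite gtr0_sg ?expr0 // subr_gt0 ltr_nat.
  by move/val_inj/perm_inj: eq_p lt_ij => ->; rewrite ltnn.
move: sgVp; rewrite detVp sgrM sgV mulr1 sgrX sgrN1 => E.
by apply: (@signr_inj int); rewrite /= signr_odd.
Qed.

(** The matrix is that of the permutation [i -> b - 1 - S_i]; the reversal turns the pairs with
    [S_i < S_j] into inversions. *)
Lemma det_inversions (R : comNzRingType) b (S : seq nat) :
    perm_eq S (iota 0 b) ->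
  \det (\matrix_(i < b, j < b) (nth 0%N S i + j.+1 == b)%:R : 'M[R]_b) =
  (-1) ^+ (\sum_(i < b) \sum_(j < b) ((i < j)%N && (nth 0%N S i < nth 0%N S j)%N)).
Proof.
move=> permS; have sizeS : size S = b by rewrite (perm_size permS) size_iota.
have ltS (i : 'I_b) : (nth 0%N S i < b)%N.
  have : nth 0%N S i \in S by rewrite mem_nth ?sizeS.
  by rewrite (perm_mem permS) mem_iota.
have uniqS : uniq S by rewrite (perm_uniq permS) iota_uniq.
pose f (i : 'I_b) := rev_ord (Ordinal (ltS i)).
have f_inj : injective f.
  move=> i j /rev_ord_inj /(congr1 val) /= /eqP.
  by rewrite nth_uniq ?sizeS // => /eqP /val_inj.
have -> : (\matrix_(i < b, j < b) (nth 0%N S i + j.+1 == b)%:R : 'M[R]_b)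
    = perm_mx (perm f_inj).
  apply/matrixP=> i j; rewrite !mxE permE; congr ((nat_of_bool _)%:R).
  by rewrite -val_eqE /=; have := ltS i; have := ltn_ord j; lia.
rewrite det_perm -[RHS]signr_odd odd_perm_inversions; congr (_ ^+ nat_of_bool (odd _)).
apply: eq_bigr => i _; apply: eq_bigr => j _; rewrite !permE /=.
by have := ltS i; have := ltS j; case: (i < j)%N => //=; lia.
Qed.

(** * Iterated derivatives of determinants *)

Section Derivatives.
Variables (C : numFieldType) (N : nat).

Lemma mderiv_prod (i : 'I_N) l (F : 'I_l -> {mpoly C[N]}) :
  mderiv i (\prod_(j < l) F j) =
  \sum_(r < l) \prod_(j < l) (if j == r then mderiv i (F j) else F j).
Proof.
elim: l F => [|l IHl] F; first by rewrite !big_ord0 -mpolyC1 mderivC.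
rewrite !big_ord_recl mderivM IHl mulr_sumr eqxx; congr (_ * _ + _).
by apply: eq_bigr => r _; rewrite big_ord_recl.
Qed.

Lemma mderiv_det (i : 'I_N) l (A : 'M[{mpoly C[N]}]_l) :
  mderiv i (\det A) =
  \sum_(r < l) \det (\matrix_(p, q) if p == r then mderiv i (A p q) else A p q).
Proof.
rewrite /determinant linear_sum exchange_big; apply: eq_bigr => s _ /=.
rewrite mulr_sign -mulr_sumr mulr_sign.
have <- : mderiv i (\prod_p A p (s p)) = \sum_(r < l) \prod_p
   (\matrix_(p, q) if p == r then mderiv i (A p q) else A p q) p (s p).
  rewrite mderiv_prod; apply: eq_bigr => r _; apply: eq_bigr => p _.
  by rewrite !mxE.
by case: (odd_perm s); rewrite ?mderivN.
Qed.

(** Arbitrary integer offsets make the family stable under differentiation: [d/dt_a] acting on one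
    row lowers its offset by [a]. *)
Definition row_det l (d : 'I_l -> int) : {mpoly C[N]} :=
  \det (\matrix_(i < l, j < l) ptz C N (d i + j%:Z)).

Lemma eq_row_det l (d d' : 'I_l -> int) : d =1 d' -> row_det d = row_det d'.
Proof.
by move=> eq_d; congr (\det _); apply/matrixP=> i j; rewrite !mxE eq_d.
Qed.

Lemma schurE mu l : size mu = l ->
  schur C N mu = row_det (fun i : 'I_l => (nth 0%N mu i)%:Z - i%:Z).
Proof. by move=> <-. Qed.

Lemma dt_mderiv a : (0 < a <= N)%N -> {i | dt a =1 @mderiv N C i}.
Proof.
case: a => // a lt_aN; exists (Ordinal lt_aN) => P.
by rewrite /dt /= insubT.
Qed.

Lemma dt_ptz a z : (0 < a <= N)%N -> dt a (ptz C N z) = ptz C N (z - a%:Z).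
Proof.
move=> aN; case: z => m /=.
  have /andP[a_gt0 le_aN] := aN; rewrite dt_pt //.
  by case: leqP => [le_am|lt_ma]; [rewrite subzn | case E: (_ - _) => //; lia].
have [i ->] := dt_mderiv aN; rewrite mderiv0.
by case E: (_ - _) => //; lia.
Qed.

Lemma dt_row_det a l (d : 'I_l -> int) : (0 < a <= N)%N ->
  dt a (row_det d) =
  \sum_(r < l) row_det (fun i => d i - (if i == r then a%:Z else 0)).
Proof.
move=> aN; have [i Ei] := dt_mderiv aN.
rewrite Ei mderiv_det; apply: eq_bigr => r _; congr (\det _).
apply/matrixP=> p q; rewrite !mxE; case: eqP => _; last by rewrite subr0.
by rewrite -Ei dt_ptz // addrAC.
Qed.

(** [dts] applies the head of the list last, whereas the inductions below differentiate by the head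
    first. *)
Lemma dts_dt s a P : all (fun b => 0 < b <= N)%N s -> (0 < a <= N)%N ->
  dts s (dt a P) = dt a (dts s P) :> {mpoly C[N]}.
Proof.
move=> + aN; elim: s => //= b s IHs /andP[bN /IHs ->].
have [i Ei] := dt_mderiv aN; have [j Ej] := dt_mderiv bN.
by rewrite !Ei !Ej mderiv_comm.
Qed.

Lemma dts_is_linear s : all (fun b => 0 < b <= N)%N s -> linear (@dts C N s).
Proof.
elim: s => //= b s IHs /andP[bN /IHs {}IHs] c P Q.
by have [i Ei] := dt_mderiv bN; rewrite /= IHs !Ei linearP.
Qed.

Section DtsLinear.
Variable s : seq nat.
Hypothesis sN : all (fun b => 0 < b <= N)%N s.

Lemma dtsD P Q : dts s (P + Q) = dts s P + dts s Q :> {mpoly C[N]}.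
Proof. by have := dts_is_linear sN 1 P Q; rewrite !scale1r. Qed.

Lemma dts0 : dts s 0 = 0 :> {mpoly C[N]}.
Proof. by apply: (@addrI _ (dts s 0)); rewrite -dtsD !addr0. Qed.

Lemma dtsZ c P : dts s (c *: P) = c *: dts s P :> {mpoly C[N]}.
Proof. by have := dts_is_linear sN c P 0; rewrite dts0 !addr0. Qed.

Lemma dts_sum (I : Type) (r : seq I) (F : I -> {mpoly C[N]}) (p : pred I) :
  dts s (\sum_(i <- r | p i) F i) = \sum_(i <- r | p i) dts s (F i).
Proof. exact: (big_morph (dts s) dtsD dts0). Qed.

End DtsLinear.

(** [tau] names, for each derivative in [s], the row on which it acts. *)
Definition lower l (d : 'I_l -> int) (s : seq nat) (tau : seq 'I_l) (i : 'I_l) :=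
  d i - \sum_(p <- zip s tau | p.2 == i) (p.1)%:Z.

Lemma lower_cons l (d : 'I_l -> int) a s r tau :
  lower d (a :: s) (r :: tau) =1
  lower (fun i => d i - (if i == r then a%:Z else 0)) s tau.
Proof.
move=> i; rewrite /lower big_cons /= eq_sym.
by case: eqP => _; rewrite ?subr0 // opprD addrA.
Qed.

Lemma row_det_lower_nil l (d : 'I_l -> int) tau :
  row_det (lower d [::] tau) = row_det d.
Proof. by apply: eq_row_det => i; rewrite /lower; case: tau => *; rewrite big_nil subr0. Qed.

Lemma row_det_lower_cons l (d : 'I_l -> int) a s r tau :
  row_det (lower d (a :: s) (r :: tau)) =
  row_det (lower (fun i => d i - (if i == r then a%:Z else 0)) s tau).
Proof. exact/eq_row_det/lower_cons. Qed.

Section RowChoices.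
Variables (S : zmodType) (phi : {additive {mpoly C[N]} -> S}) (l : nat).

(** The product rule turns the left side into a sum over all [tau]. The map [phi] will be the
    evaluation, as the terms need only vanish after it. *)
Lemma dts_row_det_eq0 s (d : 'I_l -> int) :
    all (fun b => 0 < b <= N)%N s ->
    (forall tau, size tau = size s -> phi (row_det (lower d s tau)) = 0) ->
  phi (dts s (row_det d)) = 0.
Proof.
elim: s d => [|a s IHs] d.
  by move=> _ /(_ [::] erefl); rewrite row_det_lower_nil.
move=> /= /andP[aN sN] all0.
rewrite -dts_dt // dt_row_det // dts_sum // raddf_sum big1 // => r _.
apply: IHs sN _ => tau size_tau; rewrite -row_det_lower_cons.
by apply: all0; rewrite /= size_tau.
Qed.

Lemma dts_row_det_unique s (d : 'I_l -> int) tau0 :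
    all (fun b => 0 < b <= N)%N s -> size tau0 = size s ->
    (forall tau, size tau = size s -> tau != tau0 ->
       phi (row_det (lower d s tau)) = 0) ->
  phi (dts s (row_det d)) = phi (row_det (lower d s tau0)).
Proof.
elim: s d tau0 => [|a s IHs] d tau0.
  by move=> _ _ _; rewrite row_det_lower_nil.
case: tau0 => // r0 tau0 /= /andP[aN sN] [size_tau0] all0.
rewrite -dts_dt // dt_row_det // dts_sum // raddf_sum (bigD1 r0) //=.
rewrite big1 => [|r neq_r]; last first.
  apply: dts_row_det_eq0 sN _ => tau size_tau; rewrite -row_det_lower_cons.
  by apply: all0; rewrite /= ?size_tau // eqseq_cons (negPf neq_r).
rewrite addr0 row_det_lower_cons; apply: IHs sN size_tau0 _ => tau size_tau neq_tau.
rewrite -row_det_lower_cons.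
by apply: all0; rewrite /= ?size_tau // eqseq_cons eqxx.
Qed.
End RowChoices.
End Derivatives.

(** * Determinants evaluated at [r] variables *)

Section EvaluatedDeterminants.
Variables (C : numFieldType) (N n r : nat).
Hypothesis le_rn : (r <= n)%N.
Local Notation ev := (@evx C N n r).
Local Notation h := (fun m => ev (pt C N m)).

Lemma size_first_vars : size (first_vars C n r) = r.
Proof.
rewrite /first_vars size_map size_filter -sum1_count big_enum_cond /=.
by rewrite -(big_ord_widen n (fun=> 1%N)) // sum1_card card_ord.
Qed.

Lemma evx_ptz z : ev (ptz C N z) = ext0 h z.
Proof. by case: z => m //=; rewrite rmorph0. Qed.

Lemma evx_row_detE l (d : 'I_l -> int) :
  ev (row_det C N d) = \det (\matrix_(i < l, j < l) ext0 h (d i + j%:Z)).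
Proof.
rewrite /row_det -det_map_mx; congr (\det _).
by apply/matrixP=> i j; rewrite !mxE; apply: evx_ptz.
Qed.

(** [E H = 1] is known up to degree [N]; at negative [z] both sides are zero. *)
Lemma conv_elem_poly z : z <= N%:Z ->
  conv h (elem_poly (first_vars C n r)) z = (z == 0)%:R.
Proof.
case: z => m le_mN; last by rewrite conv_neg.
by rewrite (@conv_nat _ _ N) // elem_poly_evx.
Qed.

(* With [r] variables, [1 / prod (1 - x_i k)] satisfies a linear recurrence of
   order [r], so column operations turn every column [j >= r] into an
   indicator of [d i = - j]. *)
Lemma evx_row_det l (d : 'I_l -> int) : (forall i, d i + l%:Z <= N%:Z + 1) ->
  ev (row_det C N d) = \det (\matrix_(i < l, j < l)
    if (j < r)%N then ext0 h (d i + j%:Z) else (d i + j%:Z == 0)%:R).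
Proof.
move=> dN; rewrite evx_row_detE.
rewrite (@det_conv _ _ _ r (elem_poly (first_vars C n r))).
- congr (\det _); apply/matrixP=> i j; rewrite !mxE; case: ifP => // _.
  by rewrite conv_elem_poly //; have := dN i; have := ltn_ord j; lia.
- by rewrite -[X in (_ <= X.+1)%N]size_first_vars size_elem_poly.
exact: coef0_elem_poly.
Qed.

Lemma evx_row_det_neq0 l (d : 'I_l -> int) :
    (forall i, d i + l%:Z <= N%:Z + 1) -> ev (row_det C N d) != 0 ->
  exists s : 'S_l, forall i, (r <= s i)%N -> d i + (s i)%:Z = 0.
Proof.
move=> dN; rewrite evx_row_det // => nz_det.
case: (pickP (fun s : 'S_l => [forall i, (r <= s i)%N ==> (d i + (s i)%:Z == 0)])).
  by move=> s /forallP ds; exists s => i r_si; apply/eqP/(implyP (ds i)).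
move=> no_s; case/eqP: nz_det; apply: big1 => s _.
have /negbT/forallPn[i] := no_s s; rewrite negb_imply => /andP[le_r nz_i].
by rewrite (bigD1 i) //= mxE ltnNge le_r (negPf nz_i) mul0r mulr0.
Qed.

(** The columns [j >= r] vanish in the top rows, where [d i + j > 0], and form a permutation matrix
    in the bottom rows. *)
Lemma evx_row_det_block b (d : 'I_(r + b) -> int) (S : seq nat) :
    (forall i, d i + (r + b)%:Z <= N%:Z + 1) ->
    (forall i : 'I_r, d (lshift b i) + r%:Z > 0) -> perm_eq S (iota 0 b) ->
    (forall i : 'I_b, d (rshift r i) = (nth 0%N S i)%:Z + 1 - (r + b)%:Z) ->
  ev (row_det C N d) =
  (-1) ^+ (\sum_(i < b) \sum_(j < b) ((i < j)%N && (nth 0%N S i < nth 0%N S j)%N))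
    * ev (row_det C N (fun i => d (lshift b i))).
Proof.
move=> dN d_top permS d_bot; rewrite evx_row_det // evx_row_detE.
rewrite -(@det_inversions _ b S) // mulrC.
rewrite -(@det_lblock _ _ _ _ (\matrix_(i, j) ext0 h (d (rshift r i) + j%:Z))).
congr (\det _).
apply/matrixP=> i j; rewrite !mxE.
case: (split_ordP i) => i' ->; rewrite !mxE; case: (split_ordP j) => j' -> /=.
- by rewrite [RHS]mxE.
- by rewrite [RHS]mxE; have := d_top i'; case: eqP => // E; lia.
- by rewrite [RHS]mxE.
by rewrite [RHS]mxE d_bot; congr ((nat_of_bool _)%:R); lia.
Qed.

End EvaluatedDeterminants.

(** * Uniqueness of the distribution of derivatives among the rows *)

Section Combinatorics.

(* Each of the [m] values [M u] is missed by [W], hence must be created by a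
   subtraction; so [t] is injective and [W (t j) - (W j - M j)] is again one of
   the [M u].  As [W] decreases and [M] increases, the gap [W j - M j] can
   only be realised, greedily in [j], by [t j = j]. *)
Lemma greedy_unique b m (W M t : nat -> nat) :
    (forall i j, (i < j < b)%N -> (W j < W i)%N) ->
    (forall i j, (i < j < m)%N -> (M i < M j)%N) ->
    (forall j, (j < m)%N -> (M j < b)%N) ->
    (forall i j, (i < m)%N -> (j < b)%N -> M i <> W j) ->
    (forall j, (j < m)%N -> (t j < b)%N) ->
    (forall u, (u < b)%N -> exists2 i, (i < b)%N &
       (W i)%:Z - \sum_(j < m | t j == i) ((W j)%:Z - (M j)%:Z) = u%:Z) ->
  forall j, (j < m)%N -> t j = j.
Proof.
move=> W_dec M_inc ltMb neqMW lt_tb onto.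
have M_inj i j : (i < m)%N -> (j < m)%N -> M i = M j -> i = j.
  move=> lt_im lt_jm eqM; case: (ltngtP i j) => // lt_ij.
    by have := M_inc i j; rewrite lt_ij lt_jm eqM ltnn => /(_ isT).
  by have := M_inc j i; rewrite lt_ij lt_im eqM ltnn => /(_ isT).
pose v i := (W i)%:Z - \sum_(j < m | t j == i) ((W j)%:Z - (M j)%:Z).
have /fin_all_exists [rho rhoP] : forall u : 'I_m, exists j : 'I_m, v (t j) = (M u)%:Z.
  move=> u; have [i lt_ib Ei] := onto _ (ltMb _ (ltn_ord u)).
  case: (pickP (fun j : 'I_m => t j == i)) => [j /eqP Ej|no_j].
    by exists j; rewrite Ej.
  move: Ei; rewrite big_pred0 // subr0 => -[] /esym eqMW.
  by case: (neqMW _ _ (ltn_ord u) lt_ib eqMW).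
have rho_inj : injective rho.
  move=> u u' eq_rho; apply/val_inj/(M_inj _ _ (ltn_ord u) (ltn_ord u')).
  by apply/esym/eqP; rewrite -eqz_nat -!rhoP eq_rho.
have [sigma rhoK sigmaK] := injF_bij rho_inj.
have vE j : v (t (val j)) = (M (sigma j))%:Z by rewrite -rhoP sigmaK.
(* [rho] is a bijection of ['I_m], so distinct subtractions end at distinct values and hence act on
   distinct rows. *)
have t_inj (i j : 'I_m) : t i = t j -> i = j.
  move=> eq_t; apply: (can_inj sigmaK); apply/val_inj/(M_inj _ _ (ltn_ord _) (ltn_ord _)).
  by apply/eqP; rewrite -eqz_nat -!vE eq_t.
have gapE (j : 'I_m) : (W (t j))%:Z - ((W j)%:Z - (M j)%:Z) = (M (sigma j))%:Z.
  rewrite -vE /v (bigD1 j) //= big1 ?addr0 // => i /andP[/eqP/t_inj ->].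
  by rewrite eqxx.
suff fixed j : (j < m)%N -> forall j' : 'I_m, (j' <= j)%N -> t j' = j' /\ sigma j' = j'.
  by move=> j lt_jm; have [] := fixed j lt_jm (Ordinal lt_jm) (leqnn _).
elim/ltn_ind: j => j IHj lt_jm j'; rewrite leq_eqVlt => /orP[/eqP eq_j|lt_j'j]; last first.
  exact: (IHj j' lt_j'j).
have fixed (i : 'I_m) : (i < j')%N -> t i = i /\ sigma i = i.
  by move=> lt_ij; apply: (IHj i) => //; rewrite -eq_j.
have le_t : (j' <= t j')%N.
  rewrite leqNgt; apply/negP=> lt_t.
  pose i := Ordinal (ltn_trans lt_t (ltn_ord j')); have [tt _] := fixed i lt_t.
  by have /(congr1 val) /= E := t_inj i j' tt; move: (lt_t); rewrite [X in (X < _)%N]E ltnn.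
have le_s : (j' <= sigma j')%N.
  rewrite leqNgt; apply/negP=> lt_s; have [_ ss] := fixed _ lt_s.
  by have E := can_inj sigmaK ss; rewrite E ltnn in lt_s.
have M_le : (M j' <= M (sigma j') ?= iff (j' == sigma j'))%N.
  split; first by move: le_s; rewrite leq_eqVlt => /orP[/eqP <- //|lt_s];
    rewrite ltnW // M_inc // lt_s ltn_ord.
  by apply/eqP/eqP => [/M_inj|<- //]; move=> /(_ (ltn_ord _) (ltn_ord _)) /val_inj.
have lt_tb' := lt_tb _ (ltn_ord j').
have W_le : (t j' != j' -> W (t j') < W j')%N.
  by move=> neq; apply: W_dec; rewrite lt_tb' andbT ltn_neqAle eq_sym neq.
(* [gapE] reads [W (t j') - W j' = M (sigma j') - M j'], where the left side is at most [0] and the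
   right side at least [0]. *)
have := gapE j'; case: (altP (t j' =P j' :> nat)) => [-> E|/W_le ltW E].
  split=> //; apply/eqP; rewrite eq_sym -M_le; apply/eqP.
  by lia.
by have := leqif_geq; have := M_le.1; lia.
Qed.

(* Summing [d i = s i] over the rows sent beyond [k] gives an identity between
   nonnegative excesses, all of which vanish. *)
Lemma lower_tight (k l : nat) (mu la : nat -> nat) (s : 'S_l) (a : seq nat)
    (tau : seq 'I_l) :
    (forall i j, (i <= j)%N -> (mu j <= mu i)%N) ->
    (forall i, (la i <= mu i)%N) ->
    all (ltn 0) a -> size tau = size a ->
    (\sum_(x <- a) x = \sum_(i < l | k <= i) la i)%N ->
    (forall i : 'I_l, (k <= s i)%N ->
       lower (fun i : 'I_l => (mu i)%:Z - i%:Z) a tau i + (s i)%:Z = 0) ->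
  [/\ forall i : 'I_l, (k <= i)%N -> mu i = la i,
      all (fun i : 'I_l => (k <= i)%N) tau &
      forall i : 'I_l, (k <= s i)%N -> (k <= i)%N].
Proof.
move=> mu_dec le_la a_gt0 size_tau sum_a row0.
pose I (x : bool) : int := (x : nat)%:Z.
pose d (i : nat) : int := (mu i)%:Z - i%:Z.
pose e := d k.
(* Three excesses: subtractions on rows sent before [k], growth of [mu] over [la] from [k] on, and
   the gain from selecting rows other than those with [i >= k], measured from [e]. *)
pose D1 := \sum_(p <- zip a tau) I (s p.2 < k)%N * (p.1)%:Z.
pose D2 := \sum_(i < l) I (k <= i)%N * ((mu i)%:Z - (la i)%:Z).
pose D3 := \sum_(i < l) (I (k <= s i)%N - I (k <= i)%N) * (d i - e).
have D1_ge0 p : 0 <= I (s p.2 < k)%N * (p.1)%:Z by rewrite mulr_ge0.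
have D2_ge0 (i : 'I_l) : 0 <= I (k <= i)%N * ((mu i)%:Z - (la i)%:Z).
  by rewrite mulr_ge0 // subr_ge0 lez_nat.
(* The offsets [d] strictly decrease: rows [i < k] lie at least [1] above [e], rows [i >= k] do not
   exceed it. *)
have D3_ge (i : 'I_l) : I ((k <= s i) && (i < k))%N <=
    (I (k <= s i)%N - I (k <= i)%N) * (d i - e).
  rewrite /I /e /d; have := mu_dec i k; have := mu_dec k i.
  by case: (leqP k i); case: (leqP k (s i)) => /=; lia.
(* Sum [row0] over the rows with [k <= s i] and substitute the total of [a]. As [s] is a
   permutation, the constant [e] cancels. *)
have sumD : D1 + D2 + D3 = 0.
  have sum0 : \sum_(i < l) I (k <= s i)%N *
      (lower (fun i : 'I_l => d i) a tau i + (s i)%:Z) = 0.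
    apply: big1 => i _; case: (leqP k (s i)) => [/row0 -> |]; by rewrite ?mulr0 ?mul0r.
  have sum_lower : \sum_(i < l) I (k <= s i)%N *
      (\sum_(p <- zip a tau | p.2 == i) (p.1)%:Z)
      = \sum_(p <- zip a tau) I (k <= s p.2)%N * (p.1)%:Z.
    under eq_bigr do rewrite mulr_sumr big_mkcond.
    rewrite exchange_big; apply: eq_bigr => p _ /=.
    by rewrite -big_mkcond (big_pred1 p.2) // => i; rewrite eq_sym.
  have sum_all : \sum_(p <- zip a tau) (p.1)%:Z = \sum_(i < l) I (k <= i)%N * (la i)%:Z.
    rewrite -(big_map fst predT (fun x => x%:Z)) -/unzip1 unzip1_zip ?size_tau //.
    rewrite -(big_morph _ PoszD (erefl _)) sum_a (big_morph _ PoszD (erefl _)).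
    by rewrite big_mkcond; apply: eq_bigr => i _; case: ifP; rewrite ?mul1r ?mul0r.
  have sum_perm (F : nat -> int) :
      \sum_(i < l) I (k <= s i)%N * F (s i) = \sum_(i < l) I (k <= i)%N * F i.
    by rewrite [RHS](reindex_inj (@perm_inj _ s)).
  have E1 := sum_perm (fun=> e); have E2 := sum_perm (fun i => i%:Z).
  have -> : D1 = \sum_(p <- zip a tau) (p.1)%:Z
      - \sum_(p <- zip a tau) I (k <= s p.2)%N * (p.1)%:Z.
    rewrite -sumrB; apply: eq_bigr => p _; rewrite ltnNge.
    by case: (k <= s p.2)%N; rewrite /I /= ?mul1r ?mul0r ?subrr ?subr0.
  rewrite -sum_lower sum_all.
  have -> : D2 = \sum_(i < l) I (k <= i)%N * d i + \sum_(i < l) I (k <= i)%N * i%:Z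
      - \sum_(i < l) I (k <= i)%N * (la i)%:Z.
    by rewrite -big_split -sumrB; apply: eq_bigr => i _ /=; rewrite /d; ring.
  have -> : D3 = \sum_(i < l) I (k <= s i)%N * d i - \sum_(i < l) I (k <= i)%N * d i
     - (\sum_(i < l) I (k <= s i)%N * e - \sum_(i < l) I (k <= i)%N * e).
    by rewrite -!sumrB; apply: eq_bigr => i _ /=; ring.
  rewrite E1 subrr subr0 -E2; apply: etrans sum0.
  have -> : \sum_(i < l) I (k <= s i)%N * (lower (fun i : 'I_l => d i) a tau i + (s i)%:Z)
    = \sum_(i < l) I (k <= s i)%N * d i
     - \sum_(i < l) I (k <= s i)%N * (\sum_(p <- zip a tau | p.2 == i) (p.1)%:Z)
     + \sum_(i < l) I (k <= s i)%N * (s i)%:Z.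
    by rewrite -sumrB -big_split; apply: eq_bigr => i _ /=; rewrite /lower; ring.
  ring.
have D3_ge0 (i : 'I_l) : 0 <= (I (k <= s i)%N - I (k <= i)%N) * (d i - e).
  exact: le_trans (D3_ge i).
have D1s : 0 <= D1 by apply: sumr_ge0.
have D2s : 0 <= D2 by apply: sumr_ge0.
have D3s : 0 <= D3 by apply: sumr_ge0.
have /eqP D1_0 : D1 == 0 by lia.
have /eqP D2_0 : D2 == 0 by lia.
have /eqP D3_0 : D3 == 0 by lia.
have stab (i : 'I_l) : (k <= s i)%N -> (k <= i)%N.
  move=> le_k; have := psumr_eq0P (fun i _ => D3_ge0 i) D3_0 => /(_ i isT) E.
  by have := D3_ge i; rewrite E le_k /I; case: leqP.
split=> // [i le_ki|].
  have := psumr_eq0P (fun i _ => D2_ge0 i) D2_0 => /(_ i isT).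
  by rewrite le_ki mul1r => /eqP; rewrite subr_eq0 => /eqP [].
have : all (fun p => I (s p.2 < k)%N * (p.1)%:Z == 0) (zip a tau).
  by move/eqP: D1_0; rewrite /D1 psumr_eq0.
elim: (a) (tau) a_gt0 size_tau => [|x a' IH] [|y tau'] //= /andP[x_gt0 a'_gt0] [] sz.
move=> /andP[E /(IH _ a'_gt0 sz) ->]; rewrite andbT stab // leqNgt.
by move: E; case: (s y < k)%N => //; rewrite mul1r; case: x x_gt0.
Qed.

End Combinatorics.

Lemma pleP (la mu : seq nat) : ple la mu -> forall i, (nth 0%N la i <= nth 0%N mu i)%N.
Proof.
move=> /allP le_la i; case: (ltnP i (size la)) => [lt_i|le_i].
  by apply: le_la; rewrite mem_iota.
by rewrite nth_default.
Qed.

(** * Gaps, nongaps and the partition of a gap sequence *)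

Section GapSequence.

Lemma filter_ltn_take (s : seq nat) b : sorted ltn s ->
  [seq x <- s | (x < b)%N] = take (count (fun x => x < b)%N s) s.
Proof.
elim: s => //= x s IHs sorted_xs; case: ltnP => [_|le_bx].
  by rewrite add1n IHs ?(path_sorted sorted_xs).
rewrite add0n; have all_ge : all (leq b) s.
  apply/allP=> y ys; have /allP/(_ y ys) := order_path_min ltn_trans sorted_xs.
  by move/ltnW; apply: leq_trans.
have -> : count (fun x => x < b)%N s = 0%N.
  by apply/eqP; rewrite -leqn0 leqNgt -has_count; apply/hasPn=> y /(allP all_ge);
     rewrite -leqNgt.
by apply/eqP; rewrite -size_eq0 size_filter -leqn0 leqNgt -has_count;
   apply/hasPn=> y /(allP all_ge); rewrite -leqNgt.
Qed.

Lemma sorted_nth_ge_count (s : seq nat) b i : sorted ltn s ->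
  (count (fun x => x < b)%N s <= i)%N -> (i < size s)%N -> (b <= nth 0%N s i)%N.
Proof.
move=> sorted_s le_i lt_i; rewrite leqNgt; apply/negP=> lt_b.
have : nth 0%N s i \in take (count (fun x => x < b)%N s) s.
  by rewrite -filter_ltn_take // mem_filter lt_b mem_nth.
move/(nthP 0%N) => [j]; rewrite size_take_min leq_min => /andP[lt_j _].
rewrite nth_take // => /eqP; rewrite nth_uniq ?(sorted_uniq ltn_trans ltnn) //.
  by move/eqP => E; move: lt_j; rewrite E ltnNge le_i.
by rewrite (leq_trans lt_j) // (leq_trans le_i) // ltnW.
Qed.

Variables (k b : nat) (w : seq nat).
Hypotheses (size_w : size w = (k + b)%N) (sorted_w : sorted ltn w) (w0 : 0%N \notin w).
Local Notation ng := (nongaps_below w b).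
Local Notation m := (size ng).
Local Notation W := (fun i => nth 0%N w (b - i.+1)).
Local Notation M := (nth 0%N ng).

Lemma nth_w_lt i j : (i < j < k + b)%N -> (nth 0%N w i < nth 0%N w j)%N.
Proof.
by move=> /andP[lt_ij lt_j]; rewrite (sorted_ltn_nth ltn_trans) ?inE ?size_w //;
   exact: ltn_trans lt_j.
Qed.

Lemma nth_w_gt i : (i < k + b)%N -> (i < nth 0%N w i)%N.
Proof.
elim: i => [|i IHi] lt_i.
  by rewrite lt0n; apply: contra w0 => /eqP <-; rewrite mem_nth ?size_w.
by rewrite (leq_ltn_trans (IHi (ltnW lt_i))) // nth_w_lt // ltnSn lt_i.
Qed.

Lemma below_w : [seq x <- iota 0 b | x \in w] = [seq x <- w | (x < b)%N].
Proof.
apply: (irr_sorted_eq ltn_trans ltnn).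
- by apply: (sorted_filter ltn_trans); exact: iota_ltn_sorted.
- exact: (sorted_filter ltn_trans).
by move=> x; rewrite !mem_filter mem_iota add0n andbC.
Qed.

Lemma size_nongaps_count : (m + count (fun x => x < b)%N w)%N = b.
Proof.
rewrite -size_filter -below_w !size_filter -[RHS](size_iota 0 b).
by rewrite -(count_predC (mem w)) addnC.
Qed.

Lemma size_nongaps_le : (m <= b)%N.
Proof. by rewrite -[X in (_ <= X)%N]size_nongaps_count leq_addr. Qed.

Lemma take_below : take (b - m) w = [seq x <- w | (x < b)%N].
Proof. by rewrite filter_ltn_take // -[X in (X - _)%N]size_nongaps_count addKn. Qed.

(** What the rows from [k] on hold after the greedy subtraction, with offsets shifted by [g - 1]:
    first the created nongaps, then the gaps below [b] left in place. *)
Definition completion := ng ++ rev (take (b - m) w).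

Lemma c_sourceE : c_source (k + b) w k = completion.
Proof. by rewrite /c_source /mk addKn. Qed.

Lemma perm_completion : perm_eq completion (iota 0 b).
Proof.
rewrite /completion take_below -below_w perm_catC.
rewrite perm_sym -(perm_filterC (mem w)) perm_cat2r perm_sym.
by rewrite perm_rev.
Qed.

Lemma nth_completion_lo i : (i < m)%N -> nth 0%N completion i = M i.
Proof. by move=> lt_im; rewrite /completion nth_cat lt_im. Qed.

Lemma nth_completion_hi i : (m <= i < b)%N -> nth 0%N completion i = W i.
Proof.
clear w0; move=> /andP[le_mi lt_ib]; rewrite /completion nth_cat ltnNge le_mi /=.
have lem := size_nongaps_le.
have size_t : size (take (b - m) w) = (b - m)%N.
  by rewrite size_takel // size_w (leq_trans (leq_subr _ _)) ?leq_addl.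
rewrite nth_rev ?size_t; last by lia.
rewrite nth_take; last by lia.
by congr (nth _ _ _); lia.
Qed.

Lemma nongap_lt i : (i < m)%N -> (M i < b)%N.
Proof. by move/(mem_nth 0%N); rewrite mem_filter mem_iota => /andP[_]. Qed.

Lemma nongap_notin i : (i < m)%N -> M i \notin w.
Proof. by move/(mem_nth 0%N); rewrite mem_filter => /andP[]. Qed.

Lemma nongap_inc i j : (i < j < m)%N -> (M i < M j)%N.
Proof.
move=> /andP[lt_ij lt_j]; rewrite (sorted_ltn_nth ltn_trans) ?inE //.
  by apply: (sorted_filter ltn_trans); exact: iota_ltn_sorted.
exact: ltn_trans lt_j.
Qed.

(** Exactly [b - m] gaps lie below [b], and [b - i.+1 >= b - m]. Hence the truncated subtractions in
    [a_seq] are exact. *)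
Lemma gap_ge i : (i < m)%N -> (b <= W i)%N.
Proof.
clear w0; move=> lt_im; have E := size_nongaps_count.
by apply: sorted_nth_ge_count => //; rewrite ?size_w; lia.
Qed.

Lemma a_seqE : a_seq (k + b) w k = mkseq (fun j => W j - M j)%N m.
Proof. by rewrite /a_seq /mk addKn. Qed.

Lemma nth_gap_lambda i : (i < k + b)%N ->
  nth 0%N (gap_lambda (k + b) w) i =
  (nth 0%N w (k + b - i.+1) - (k + b - i.+1))%N.
Proof.
by move=> lt_i; rewrite /gap_lambda (nth_map 0%N) ?size_iota // nth_iota.
Qed.

Lemma size_gap_lambda : size (gap_lambda (k + b) w) = (k + b)%N.
Proof. by rewrite /gap_lambda size_map size_iota. Qed.

(** As [0] is not a gap, the gap of index [i] exceeds [i]. *)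
Lemma gap_lambda_gt0 i : (i < k + b)%N -> (0 < nth 0%N (gap_lambda (k + b) w) i)%N.
Proof.
move=> lt_i; rewrite nth_gap_lambda // subn_gt0.
by apply: nth_w_gt; lia.
Qed.

Lemma ple_size mu : ple (gap_lambda (k + b) w) mu -> (k + b <= size mu)%N.
Proof.
move=> le_lam; rewrite leqNgt; apply/negP=> lt_size.
have := pleP le_lam (size mu); rewrite [X in (_ <= X)%N]nth_default //.
by rewrite leqNgt gap_lambda_gt0.
Qed.

Lemma gap_lambda_bottom i : (i < b)%N ->
  (nth 0%N (gap_lambda (k + b) w) (k + i) + (b - i.+1))%N = W i.
Proof.
move=> lt_ib; rewrite nth_gap_lambda ?ltn_add2l //.
have -> : (k + b - (k + i).+1 = b - i.+1)%N by lia.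
have : (b - i.+1 < k + b)%N by lia.
by move/nth_w_gt; lia.
Qed.

(** Adding the entries of [completion] to the left and the equal sum [0 + ... + (b - 1)] to the
    right gives the sum of the [W i] on both sides. *)
Lemma sum_a_seq :
  (\sum_(x <- a_seq (k + b) w k) x =
   \sum_(i < b) nth 0%N (gap_lambda (k + b) w) (k + i))%N.
Proof.
have sumS : (\sum_(i < b) nth 0%N completion i = \sum_(i < b) (b - i.+1))%N.
  rewrite -(big_mkord predT (nth 0%N completion)).
  have size_completion : size completion = b by rewrite (perm_size perm_completion) size_iota.
  rewrite -[in LHS]size_completion -(big_nth 0%N predT id) (perm_big _ perm_completion) /=.
  rewrite -[in iota 0 b](subn0 b) -/(index_iota 0 b) big_mkord.
  exact: (reindex_inj rev_ord_inj).
rewrite a_seqE big_map -[in iota 0 m](subn0 m) -/(index_iota 0 m) big_mkord.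
rewrite (big_ord_widen b (fun i => W i - M i)%N) ?size_nongaps_le // big_mkcond.
apply/eqP; rewrite -(eqn_add2r (\sum_(i < b) nth 0%N completion i)) -big_split.
rewrite sumS -big_split; apply/eqP/eq_bigr => i _ /=.
rewrite gap_lambda_bottom //; case: ltnP => [lt_im|le_mi].
  by rewrite nth_completion_lo // subnK // (leq_trans _ (gap_ge lt_im)) // ltnW // nongap_lt.
by rewrite nth_completion_hi ?le_mi ?ltn_ord.
Qed.

End GapSequence.

(** * Parts and weights of partitions *)

Section Partitions.
Variable mu : seq nat.
Hypothesis part_mu : is_partition mu.

Lemma partition_nth_dec i j : (i <= j)%N -> (nth 0%N mu j <= nth 0%N mu i)%N.
Proof.
move=> le_ij; case: (ltnP j (size mu)) => [lt_j|le_j]; last by rewrite [X in (X <= _)%N]nth_default.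
have /andP[sorted_mu _] := part_mu.
apply: (sorted_leq_nth _ _ 0%N sorted_mu) => //.
  by move=> x y z le1 le2; apply: leq_trans le2 le1.
exact: leq_ltn_trans lt_j.
Qed.

Lemma partition_nth_gt0 i : (0 < nth 0%N mu i)%N = (i < size mu)%N.
Proof.
case: (ltnP i (size mu)) => [lt_i|le_i]; last by rewrite nth_default.
by have /andP[_ /allP pos_mu] := part_mu; apply/pos_mu/mem_nth.
Qed.

(** Every other row adds at least one to the weight. The weight therefore bounds all indices of the
    [p_m] in the Schur determinant. *)
Lemma partition_hook i : (i < size mu)%N -> (nth 0%N mu i + size mu <= (psize mu).+1)%N.
Proof.
move=> lt_i; rewrite /psize (big_nth 0%N) big_mkord (bigD1 (Ordinal lt_i)) //=.
rewrite -addnS leq_add2l -[X in (X <= _)%N](card_ord (size mu)).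
rewrite (cardD1 (Ordinal lt_i)) -sum1_card add1n ltnS.
rewrite (eq_bigl (fun j => j != Ordinal lt_i)); last by move=> j; rewrite !inE andbT.
by apply: leq_sum => j _; rewrite partition_nth_gt0.
Qed.

End Partitions.

Lemma lowerE l (d : 'I_l -> int) s tau i : size tau = size s ->
  lower d s tau i =
  d i - \sum_(0 <= j < size s | nth 0%N (map val tau) j == i) (nth 0%N s j)%:Z.
Proof.
move=> eq_size; rewrite /lower (big_nth (0%N, i)) size1_zip ?eq_size //.
congr (_ - _); rewrite !big_mkord; apply: eq_big => [j|j _]; rewrite nth_zip //=.
by rewrite (nth_map i) ?eq_size.
Qed.

(** * Derivatives of a single Schur polynomial, with [g = k + b] *)

Section DerivedSchur.
Variables (C : numFieldType) (N k b : nat) (w mu : seq nat).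
Hypotheses (size_w : size w = (k + b)%N) (sorted_w : sorted ltn w) (w0 : 0%N \notin w).
Hypotheses (part_mu : is_partition mu).
Local Notation g := (k + b)%N.
Local Notation lam := (gap_lambda g w).
Local Notation a := (a_seq g w k).
Hypotheses (le_lam : ple lam mu) (muN : (psize mu <= N)%N).
Hypothesis (aN : all (fun x => x <= N)%N a).
Local Notation ev := (@evx C N k k).
Local Notation d l := (fun i : 'I_l => (nth 0%N mu i)%:Z - i%:Z).

Lemma a_seq_gt0 : all (ltn 0) a.
Proof.
rewrite a_seqE; apply/allP=> x /mapP[j]; rewrite mem_iota => /andP[_ lt_j] ->.
rewrite /= subn_gt0; move: lt_j; rewrite add0n => lt_j.
exact: (leq_trans (nongap_lt lt_j) (gap_ge size_w sorted_w lt_j)).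
Qed.

Lemma a_seq_range : all (fun x => 0 < x <= N)%N a.
Proof.
apply/allP=> x xa; apply/andP; split.
  exact: (allP a_seq_gt0).
exact: (allP aN).
Qed.

Lemma lower_bound l tau i : size mu = l -> lower (d l) a tau i + l%:Z <= N%:Z + 1.
Proof.
move=> size_mu; have lt_i : (i < size mu)%N by rewrite size_mu.
have := partition_hook part_mu lt_i; rewrite size_mu /lower.
have : 0 <= \sum_(p <- zip a tau | p.2 == i) (p.1)%:Z :> int by apply: sumr_ge0.
by lia.
Qed.

Lemma sum_a_seq_ord l : (g <= l)%N ->
  (\sum_(x <- a) x = \sum_(i < l | k <= i) nth 0%N lam i)%N.
Proof.
move=> le_gl; rewrite sum_a_seq // -(big_geq_mkord k l predT (nth 0%N lam)).
rewrite (big_cat_nat (n := g)) ?leq_addr //=.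
have -> : (\sum_(g <= i < l) nth 0%N lam i = 0)%N.
  rewrite big_nat_cond big1 // => i /andP[/andP[le_gi _] _].
  by rewrite nth_default // size_gap_lambda.
rewrite addn0 -[X in index_iota X _]add0n big_addn addKn big_mkord.
by apply: eq_bigr => i _; rewrite [(k + i)%N]addnC.
Qed.

Lemma row_det_lower_tight l tau : size mu = l -> size tau = size a ->
    ev (row_det C N (lower (d l) a tau)) != 0 ->
  exists s : 'S_l, [/\ forall i, (k <= s i)%N -> lower (d l) a tau i + (s i)%:Z = 0,
     forall i, (k <= i < l)%N -> nth 0%N mu i = nth 0%N lam i,
     all (fun i : 'I_l => (k <= i)%N) tau &
     forall i : 'I_l, (k <= s i)%N -> (k <= i)%N].
Proof.
move=> size_mu size_tau nz.
have [s row0] := evx_row_det_neq0 (leqnn k) (fun i => lower_bound tau i size_mu) nz.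
have le_gl : (g <= l)%N by rewrite -size_mu (ple_size size_w sorted_w w0 le_lam).
have [eq_mu tau_k stab] := lower_tight (partition_nth_dec part_mu) (pleP le_lam)
  a_seq_gt0 size_tau (sum_a_seq_ord le_gl) row0.
exists s; split=> // i /andP[le_ki lt_il].
exact: (eq_mu (Ordinal lt_il)).
Qed.

Definition matches :=
  (size mu <= g)%N && all (fun i => nth 0%N mu i == nth 0%N lam i) (iota k b).

Lemma dts_schur_mismatch : ~~ matches -> ev (dts a (schur C N mu)) = 0.
Proof.
move=> mismatch; rewrite (schurE C N erefl).
apply: (dts_row_det_eq0 (phi := ev)) a_seq_range _ => tau size_tau.
apply/eqP; apply: contraR mismatch => nz.
have [s [_ eq_mu _ _]] := row_det_lower_tight erefl size_tau nz.
apply/andP; split.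
  (* With more than [g] parts, the entry of index [g] would be positive, yet equal to the default
     [0] of [lam]. *)
  rewrite leqNgt; apply/negP=> lt_g.
  have := eq_mu g; rewrite leq_addr lt_g => /(_ isT) E.
  by have := partition_nth_gt0 part_mu g; rewrite E lt_g nth_default // size_gap_lambda.
apply/allP=> i; rewrite mem_iota => /andP[le_ki lt_ig]; apply/eqP/eq_mu.
by rewrite le_ki (leq_trans lt_ig) // (ple_size size_w sorted_w w0 le_lam).
Qed.

Definition greedy : seq 'I_g :=
  [seq rshift k (widen_ord (size_nongaps_le b sorted_w) j)
  | j <- enum 'I_(size (nongaps_below w b))].

Lemma size_a_seq : size a = size (nongaps_below w b).
Proof. by rewrite a_seqE size_mkseq. Qed.

Lemma val_greedy : map val greedy = iota k (size (nongaps_below w b)).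
Proof.
rewrite /greedy -map_comp (eq_map (g := addn k \o val)) // map_comp val_enum_ord.
by rewrite -iotaDl addn0.
Qed.

Lemma nth_a_seq j : (j < size (nongaps_below w b))%N ->
  (nth 0%N a j)%:Z = (nth 0%N w (b - j.+1))%:Z - (nth 0%N (nongaps_below w b) j)%:Z.
Proof.
move=> lt_j; rewrite a_seqE nth_mkseq // subzn //.
exact: ltnW (leq_trans (nongap_lt lt_j) (gap_ge size_w sorted_w lt_j)).
Qed.

Lemma greedy_only tau : size mu = g -> size tau = size a ->
  ev (row_det C N (lower (d g) a tau)) != 0 -> tau = greedy.
Proof.
move=> size_mu size_tau nz.
have [s [row0 eq_mu tau_k stab]] := row_det_lower_tight size_mu size_tau nz.
have size_taum : size tau = size (nongaps_below w b) by rewrite size_tau size_a_seq.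
have tau_mem j : (j < size (nongaps_below w b))%N -> (k <= nth 0%N (map val tau) j < g)%N.
  move=> lt_j; have : nth 0%N (map val tau) j \in map val tau.
    by rewrite mem_nth // size_map size_taum.
  by move=> /mapP[i /(allP tau_k) le_ki ->]; rewrite le_ki ltn_ord.
apply: (inj_map val_inj); rewrite val_greedy.
apply: (@eq_from_nth _ 0%N); first by rewrite size_map size_iota.
move=> j; rewrite size_map size_taum => lt_j; rewrite nth_iota //.
have [le_k lt_g] := andP (tau_mem j lt_j).
suff : (nth 0%N (map val tau) j - k)%N = j by move=> E; rewrite -[in RHS]E subnKC.
apply: (@greedy_unique b (size (nongaps_below w b)) (fun i => nth 0%N w (b - i.+1))
  (nth 0%N (nongaps_below w b)) (fun j => nth 0%N (map val tau) j - k)%N _ _ _ _ _ _ j lt_j).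
- move=> i i' lt_ii; apply: (nth_w_lt size_w sorted_w).
  by case/andP: lt_ii; lia.
- exact: nongap_inc.
- exact: nongap_lt.
- move=> i i' lt_i lt_i' E; have := nongap_notin lt_i.
  by rewrite E mem_nth // size_w; lia.
- by move=> i /tau_mem; lia.
move=> u lt_u.
(* The row that [s] sends to column [q = g - 1 - u] has lowered offset [-q], which is [u] after the
   shift by [g - 1]. *)
pose q := rshift k (rev_ord (Ordinal lt_u)); pose i0 := (s^-1)%g q.
have s_i0 : s i0 = q by rewrite /i0 permKV.
have := row0 i0; rewrite s_i0 => /(_ (leq_addr _ _)).
have le_k0 : (k <= i0)%N by apply: stab; rewrite s_i0 leq_addr.
rewrite (lowerE _ _ size_tau) size_a_seq eq_mu ?le_k0 ?ltn_ord // => E.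
exists (i0 - k)%N; first by have := ltn_ord i0; lia.
have -> : \sum_(j < size (nongaps_below w b) | (nth 0%N (map val tau) j - k)%N == (i0 - k)%N)
    ((nth 0%N w (b - j.+1))%:Z - (nth 0%N (nongaps_below w b) j)%:Z)
  = \sum_(0 <= j < size (nongaps_below w b) | nth 0%N (map val tau) j == i0) (nth 0%N a j)%:Z.
  rewrite big_mkord; apply: eq_big => [j'|j' _]; last by rewrite nth_a_seq.
  by have := tau_mem j' (ltn_ord j'); lia.
have lt_i0 : (i0 - k < b)%N by have := ltn_ord i0; lia.
have := gap_lambda_bottom size_w sorted_w w0 lt_i0; rewrite subnKC // => bottom.
by move: E bottom; set X := \sum_(0 <= j < _ | _) _; rewrite /q /=; lia.
Qed.

Lemma dts_schur_match :
  matches -> ev (dts a (schur C N mu)) = c_sign C g w k *: ev (schur C N (take k mu)).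
Proof.
move=> /andP[le_size /allP eq_lam].
have size_mu : size mu = g.
  by apply/eqP; rewrite eqn_leq le_size (ple_size size_w sorted_w w0 le_lam).
rewrite (schurE C N size_mu).
have size_greedy : size greedy = size a by rewrite size_map size_enum_ord size_a_seq.
transitivity (ev (row_det C N (lower (d g) a greedy))).
  apply: (dts_row_det_unique (phi := ev) a_seq_range size_greedy).
  move=> tau size_tau neq; apply/eqP; apply: contraR neq => nz.
  exact/eqP/greedy_only.
have top (i : 'I_k) : lower (d g) a greedy (lshift b i) = (nth 0%N mu i)%:Z - i%:Z.
  rewrite (lowerE _ _ size_greedy) big_nat_cond big_pred0 ?subr0 // => j.
  rewrite val_greedy size_a_seq; case: (ltnP j) => //= lt_j.
  by rewrite nth_iota //; have := ltn_ord i; lia.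
rewrite (@evx_row_det_block C N k k (leqnn k) b _ (completion b w)) //=.
- rewrite /c_sign c_sourceE.
  have -> : size (completion b w) = b.
    by rewrite (perm_size (perm_completion b sorted_w)) size_iota.
  rewrite -[in RHS]signr_odd scaler_sign -[in LHS]signr_odd mulr_sign.
  have -> : row_det C N (fun i => lower (d g) a greedy (lshift b i)) = schur C N (take k mu).
    have size_k : size (take k mu) = k by rewrite size_takel // size_mu leq_addr.
    by rewrite (schurE C N size_k); apply: eq_row_det => i; rewrite top nth_take.
  by [].
- by move=> i; apply: lower_bound.
- by move=> i; rewrite top; have := ltn_ord i; lia.
- exact: (perm_completion b sorted_w).
move=> i; rewrite (lowerE _ _ size_greedy) val_greedy size_a_seq /=.
have bottom := gap_lambda_bottom size_w sorted_w w0 (ltn_ord i).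
have /eqP -> : nth 0%N mu (k + i) == nth 0%N lam (k + i).
  by apply: eq_lam; rewrite mem_iota leq_addr ltn_add2l ltn_ord.
have lt_i := ltn_ord i.
case: (ltnP i (size (nongaps_below w b))) => [lt_im|le_mi].
  rewrite big_mkord (big_pred1 (Ordinal lt_im)) /=; last first.
    by move=> j; rewrite nth_iota // eqn_add2l.
  by rewrite nth_a_seq // nth_completion_lo //; lia.
rewrite big_nat_cond big_pred0 => [|j].
  rewrite (nth_completion_hi size_w sorted_w) ?le_mi //; lia.
by case: (ltnP j) => //= lt_j; rewrite nth_iota // eqn_add2l; lia.
Qed.

End DerivedSchur.

(** * The lowest power of the last variable in a Schur polynomial *)

Section LastVariable.
Variables (C : numFieldType).

Lemma mcoeff_mulXn_eq0 n (p : {mpoly C[n]}) (i : 'I_n) e (m : 'X_{1..n}) :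
  (m i < e)%N -> (p * 'X_i ^+ e)@_m = 0.
Proof.
move=> lt_me; rewrite mcoeffM big1 // => -[m1 m2] /= /eqP Em.
rewrite mpolyXn mcoeffX; case: eqP => [E|_]; last by rewrite mulr0.
move: lt_me; rewrite {1}(congr1 (fun m : 'X_{1..n} => m i) Em).
by rewrite mnmDE -E mulmnE mnm1E eqxx mul1n ltnNge leq_addl.
Qed.

Variables (N k : nat).
Local Notation x := ('X_ord_max : {mpoly C[k.+1]}).

Definition congX (p q : {mpoly C[k.+1]}) := exists u, p = q + u * x.

Lemma congX_refl p : congX p p.
Proof. by exists 0; rewrite mul0r addr0. Qed.

Lemma congXD p p' q q' : congX p q -> congX p' q' -> congX (p + p') (q + q').
Proof. by move=> [u ->] [u' ->]; exists (u + u'); ring. Qed.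

Lemma congXM p p' q q' : congX p q -> congX p' q' -> congX (p * p') (q * q').
Proof. by move=> [u ->] [u' ->]; exists (u * q' + q * u' + u * x * u'); ring. Qed.

Lemma congX_exp p q e : congX p q -> congX (p ^+ e) (q ^+ e).
Proof.
by move=> pq; elim: e => [|e IHe]; [exact: congX_refl | rewrite !exprS; exact: congXM].
Qed.

Lemma sum_powers_last (F : 'I_k.+1 -> {mpoly C[k.+1]}) :
  \sum_(i < k.+1 | (i < k.+1)%N) F i = \sum_(i < k.+1 | (i < k)%N) F i + F ord_max.
Proof.
rewrite (bigD1 ord_max) //= addrC; congr (_ + _); apply: eq_bigl => i.
by rewrite ltn_ord /= -val_eqE /=; have := ltn_ord i; lia.
Qed.

(** Including the last variable changes [t_(j+1)] by [x ^ (j+1) / (j+1)], a multiple of [x]. *)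
Lemma evx_congX (P : {mpoly C[N]}) : congX (evx k.+1 k.+1 P) (evx k.+1 k P).
Proof.
rewrite /evx /mmap; apply: (big_ind2 congX) => [|p q p' q'|m _].
- exact: congX_refl.
- exact: congXD.
apply: congXM; first exact: congX_refl.
rewrite /mmap1; apply: (big_ind2 congX) => [|p q p' q'|j _].
- exact: congX_refl.
- exact: congXM.
apply: congX_exp; rewrite sum_powers_last.
by exists (j.+1%:R^-1 *: x ^+ j); rewrite -scalerAl -exprSr scalerDr.
Qed.

Lemma first_vars_last :
  first_vars C k.+1 k.+1 = rcons (first_vars C k.+1 k) 'X_ord_max.
Proof.
rewrite /first_vars enum_ordSr !filter_rcons /= ltnn ltnSn map_rcons.
congr (rcons (map _ _) _); apply: eq_in_filter => i /mapP[j _ ->] /=.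
by have := ltn_ord j; lia.
Qed.

Lemma conv_first_vars m : (m <= N)%N ->
  conv (fun i => evx k.+1 k.+1 (pt C N i)) (elem_poly (first_vars C k.+1 k)) m%:Z
  = 'X_ord_max ^+ m.
Proof.
move=> le_mN; rewrite (@conv_nat _ _ N) //.
apply: (@elem_poly_rcons_inv _ N) => // i le_iN.
by rewrite -first_vars_last elem_poly_evx.
Qed.

(** After column operations, the last column has entries [x ^ (nu_i + k - i)], and only its last
    entry has an exponent as low as [nu_k]. *)
Lemma evx_schur_last nu (m : 'X_{1..k.+1}) L :
    size nu = k.+1 -> is_partition nu -> (psize nu <= N)%N ->
    (L <= nth 0%N nu k)%N -> (m ord_max <= L)%N ->
  (evx k.+1 k.+1 (schur C N nu))@_m =
  if nth 0%N nu k == L then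
    (evx k.+1 k (schur C N (take k nu)) * 'X_ord_max ^+ L)@_m else 0.
Proof.
move=> size_nu part_nu nuN le_L le_mL.
pose h i := evx k.+1 k.+1 (pt C N i).
rewrite (schurE C N size_nu) evx_row_detE.
rewrite (@det_conv _ h _ k (elem_poly (first_vars C k.+1 k))); first last.
- exact: coef0_elem_poly.
- by rewrite -[X in (_ <= X.+1)%N](size_first_vars C (leqnSn k)) size_elem_poly.
set A := \matrix_(i, j) _.
have A_last (i : 'I_k.+1) : A i ord_max = 'X_ord_max ^+ (nth 0%N nu i + (k - i)).
  rewrite mxE ltnn.
  have lt_i : (i < size nu)%N by rewrite size_nu.
  have := partition_hook part_nu lt_i; rewrite size_nu => hook.
  have -> : (nth 0%N nu i)%:Z - i%:Z + (ord_max : 'I_k.+1)%:Z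
    = (nth 0%N nu i + (k - i))%N%:Z.
    by have := ltn_ord i; rewrite /=; lia.
  by rewrite conv_first_vars //; lia.
rewrite (expand_det_col A ord_max) (bigD1 ord_max) //= mcoeffD raddf_sum big1.
  rewrite /= addr0 A_last subnn addn0 /cofactor -signr_odd addnn odd_double mul1r.
  (* Columns before [k] are untouched, so the minor is again a Schur polynomial, still in all
     [k + 1] variables. *)
  have -> : \det (row' ord_max (col' ord_max A)) = evx k.+1 k.+1 (schur C N (take k nu)).
    have size_k : size (take k nu) = k by rewrite size_takel // size_nu.
    rewrite (schurE C N size_k) evx_row_detE; congr (\det _).
    apply/matrixP=> i j; rewrite !mxE.
    by rewrite !lift_max ltn_ord nth_take.
  have [u ->] := evx_congX (schur C N (take k nu)); rewrite mulrC.
  case: eqP => [->|neq_L]; last first.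
    rewrite mcoeff_mulXn_eq0 //= (leq_ltn_trans le_mL) // ltn_neqAle le_L andbT.
    by apply/eqP => /esym.
  (* Dropping the last variable from the minor costs a multiple of [x ^ (L+1)], invisible at
     exponents up to [L]. *)
  by rewrite mulrDl mcoeffD -mulrA -exprS [X in _ + X]mcoeff_mulXn_eq0 ?addr0.
move=> i neq_i /=; rewrite A_last mulrC mcoeff_mulXn_eq0 //.
have lt_ik : (i < k)%N by move: neq_i; rewrite -val_eqE /=; have := ltn_ord i; lia.
by have := partition_nth_dec part_nu (ltnW lt_ik); move: le_L le_mL lt_ik; lia.
Qed.

End LastVariable.

(** * The partitions encoded by [canon] functions *)

Section PartitionEnumeration.
Variables (B : nat) (f : {ffun 'I_B -> 'I_B}).
Hypothesis canon_f : canon f.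

Lemma is_partition_part_of : is_partition (part_of f).
Proof.
have /andP[/forallP dec_f _] := canon_f.
apply/andP; split; last by apply/allP=> x /mapP[i]; rewrite mem_filter => /andP[? _] ->.
rewrite /part_of sorted_map; apply: sorted_filter => [x y z /= le1 le2|].
  exact: leq_trans le2 le1.
have : sorted ltn (map val (enum 'I_B)) by rewrite val_enum_ord iota_ltn_sorted.
rewrite sorted_map; apply: sub_sorted => i j /= lt_ij.
by have /forallP/(_ j)/implyP/(_ (ltnW lt_ij)) := dec_f i.
Qed.

Lemma psize_part_of : (psize (part_of f) < B)%N.
Proof.
have /andP[_] := canon_f; rewrite /psize /part_of big_map big_filter big_enum_cond /=.
suff -> : (\sum_(i < B | 0 < f i) f i = \sum_(i < B) f i)%N by [].
by rewrite big_mkcond; apply: eq_bigr => i _; case: posnP.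
Qed.

End PartitionEnumeration.

(** * Truncations of [tau] and [tau^(k)] *)

Section TruncatedTau.
Variables (C : numFieldType) (g : nat) (w : seq nat) (xi : seq nat -> C).
Hypotheses (size_w : size w = g) (sorted_w : sorted ltn w) (w0 : 0%N \notin w).
Local Notation lam := (gap_lambda g w).

Lemma size_lam : size lam = g.
Proof. exact: (@size_gap_lambda 0 g). Qed.

Lemma is_partition_gap_lambda : is_partition lam.
Proof.
have sz : size w = (0 + g)%N by [].
apply/andP; split; last first.
  by apply/(all_nthP 0%N) => i; rewrite size_lam; apply: (@gap_lambda_gt0 0 g w).
apply/(sortedP 0%N) => i; rewrite size_lam => lt_i.
rewrite !(@nth_gap_lambda 0 g) ?(ltnW lt_i) // add0n.
have lt1 : (g - i.+2 < g - i.+1 < 0 + g)%N by lia.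
have := nth_w_lt sz sorted_w lt1.
have lt2 : (g - i.+2 < 0 + g)%N by lia.
by have := nth_w_gt sz sorted_w w0 lt2; lia.
Qed.

Lemma ple_refl s : ple s s.
Proof. exact/allP. Qed.

Lemma plt_mismatch mu : is_partition mu -> plt lam mu -> (size mu <= g)%N ->
  ~~ all (fun i => nth 0%N mu i == nth 0%N lam i) (iota 0 g).
Proof.
move=> part_mu /andP[le_lam neq] le_size; apply: contra neq => /allP eq_lam.
have size_mu : size mu = g.
  by apply/eqP; rewrite eqn_leq le_size (@ple_size 0 g w).
apply/eqP/(@eq_from_nth _ 0%N); first by rewrite size_lam.
move=> i; rewrite size_lam => lt_i; apply/esym/eqP/eq_lam.
by rewrite mem_iota.
Qed.

Lemma schur_nil N : schur C N [::] = 1.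
Proof. by rewrite /schur det_mx00. Qed.

(** At [k = 0] the conditions would force [mu = lam], so the sum is empty and the general formula
    agrees with the convention [tau^(0) = 1]. *)
Lemma tauk_partE k B :
  tauk_part g lam xi k B = schur C B (take k lam) +
  \sum_(f : {ffun 'I_B -> 'I_B} |
          [&& canon f, plt lam (part_of f), (size (part_of f) <= g)%N &
           all (fun i => nth 0%N (part_of f) i == nth 0%N lam i) (iota k (g - k))])
     xi (part_of f) *: schur C B (take k (part_of f)).
Proof.
rewrite /tauk_part; case: eqP => // ->; rewrite take0 schur_nil big1 ?addr0 // => f.
case/and4P=> canon_f lt_lam le_size; rewrite subn0.
by rewrite (negPf (plt_mismatch (is_partition_part_of canon_f) lt_lam le_size)).
Qed.

(** The bound brings [lam] and every [a_j] within range of the [B] variables; for [a_j > B], [dt]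
    would be zero by default. *)
Lemma evx_dts_tau_part k b B : g = (k + b)%N ->
    (psize lam + psize (a_seq g w k) <= B)%N ->
  evx k k (dts (a_seq g w k) (tau_part lam xi B)) =
  c_sign C g w k *: evx k k (tauk_part g lam xi k B).
Proof.
move=> eg; have size_w' : size w = (k + b)%N by rewrite -eg.
have := is_partition_gap_lambda; have := tauk_partE k B; have := size_lam.
rewrite /tau_part eg addKn => size_lam -> part_lam le_B.
have aB : all (fun x => x <= B)%N (a_seq (k + b) w k).
  apply/allP=> x xa; apply: leq_trans le_B; apply: leq_trans (leq_addl _ _).
  by rewrite /psize (big_rem x xa) leq_addr.
have aB' := a_seq_range size_w' sorted_w aB.
have lamB : (psize (gap_lambda (k + b) w) <= B)%N by apply: leq_trans le_B; rewrite leq_addr.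
rewrite (dtsD aB') !evxD scalerDr.
congr (_ + _).
  apply: dts_schur_match; rewrite ?ple_refl //.
  by rewrite /matches size_lam leqnn; apply/allP.
rewrite (dts_sum aB') !evx_sum scaler_sumr.
rewrite big_mkcond [RHS]big_mkcond; apply: eq_bigr => f _ /=.
case canon_f: (canon f) => //=; case: ifP => //= lt_lam.
have part_f := is_partition_part_of canon_f.
have sizeB := ltnW (psize_part_of canon_f).
have /andP[le_lam _] := lt_lam.
rewrite (dtsZ aB') evxZ -/(matches k b w (part_of f)).
case: ifP => [match_f|/negbT mismatch_f].
  by rewrite dts_schur_match // evxZ !scalerA mulrC.
by rewrite dts_schur_mismatch ?scaler0.
Qed.

Lemma evx_tauk_part_last k B (m : 'X_{1..k.+1}) : (k < g)%N ->
    (psize lam <= B)%N -> (m ord_max <= nth 0%N lam k)%N ->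
  (evx k.+1 k.+1 (tauk_part g lam xi k.+1 B))@_m =
  (evx k.+1 k (tauk_part g lam xi k B) * 'X_ord_max ^+ nth 0%N lam k)@_m.
Proof.
move=> lt_kg lamB le_m; rewrite !tauk_partE !evxD mulrDl !mcoeffD.
have take_part nu : is_partition nu -> is_partition (take k.+1 nu).
  move=> /andP[sorted_nu pos_nu]; rewrite /is_partition take_sorted //=.
  by apply/allP=> x /mem_take; apply/allP.
have psize_take nu : (psize (take k.+1 nu) <= psize nu)%N.
  by rewrite -[X in (_ <= psize X)%N](cat_take_drop k.+1) /psize big_cat leq_addr.
have step nu : is_partition nu -> ple lam nu -> (psize nu <= B)%N ->
    (evx k.+1 k.+1 (schur C B (take k.+1 nu)))@_m =
    if nth 0%N nu k == nth 0%N lam k then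
      (evx k.+1 k (schur C B (take k nu)) * 'X_ord_max ^+ nth 0%N lam k)@_m else 0.
  move=> part_nu le_nu nuB.
  have size_nu : size (take k.+1 nu) = k.+1.
    rewrite size_takel // (leq_trans lt_kg) //.
    exact: (@ple_size 0 g w).
  have nth_nu : nth 0%N (take k.+1 nu) k = nth 0%N nu k by rewrite nth_take.
  have take_nu : take k (take k.+1 nu) = take k nu by rewrite take_takel.
  have le_k : (nth 0%N lam k <= nth 0%N (take k.+1 nu) k)%N by rewrite nth_nu pleP.
  have := evx_schur_last C size_nu (take_part _ part_nu)
    (leq_trans (psize_take nu) nuB) le_k le_m.
  by rewrite nth_nu take_nu.
congr (_ + _).
  by rewrite step ?is_partition_gap_lambda ?ple_refl // eqxx.
rewrite !evx_sum mulr_suml !raddf_sum /=.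
rewrite big_mkcond [RHS]big_mkcond; apply: eq_bigr => f _ /=.
(* The condition for [k] is that for [k+1] together with equality at index [k]; partitions failing
   only this equality contribute [0] by [step]. *)
have -> : iota k (g - k) = k :: iota k.+1 (g - k.+1) by rewrite -(subnSK lt_kg).
case canon_f: (canon f) => //=; case lt_lam: (plt lam (part_of f)) => //=.
case: (size _ <= g)%N => //=; have /andP[le_lam _] := lt_lam.
have part_f := is_partition_part_of canon_f.
have := step _ part_f le_lam (ltnW (psize_part_of canon_f)).
case: (all _ _); last by rewrite andbF.
rewrite andbT !evxZ -scalerAl !mcoeffZ => ->.
by case: ifP => // _; rewrite mulr0.
Qed.

End TruncatedTau.

(* Identities of formal power series in x_1..x_k are stated coefficient *)
(* by coefficient: for every monomial m, the coefficient of m in the      *)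
(* evaluation of the partial sums (over partitions of weight < B) is      *)
(* eventually (for all large B) the claimed one.                          *)
Theorem theorem3p1 (C : numClosedFieldType) (g : nat) (w : seq nat)
    (xi : seq nat -> C) :
  is_gap_seq g w ->
  let lam := gap_lambda g w in
  (* (i) *)
  (forall k : nat, (k <= g)%N ->
     forall m : 'X_{1..k}, exists B0 : nat, forall B : nat, (B0 <= B)%N ->
       (evx k k (dts (a_seq g w k) (tau_part lam xi B)))@_m =
       (c_sign C g w k *: evx k k (tauk_part g lam xi k B))@_m)
  /\
  (* (ii), stated for k+1 with 0 <= k < g: coefficients of monomials whose *)
  (* exponent of x_{k+1} is <= lam_{k+1} agree                             *)
  (forall k : nat, (k < g)%N ->
     forall m : 'X_{1..k.+1}, (m ord_max <= nth 0%N lam k)%N ->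
     exists B0 : nat, forall B : nat, (B0 <= B)%N ->
       (evx k.+1 k.+1 (tauk_part g lam xi k.+1 B))@_m =
       (evx k.+1 k (tauk_part g lam xi k B) * 'X_ord_max ^+ nth 0%N lam k)@_m).
Proof.
move=> [_ size_w sorted_w w0 _] lam; split=> k.
  (* The truncated sums agree as whole polynomials, so [B0] is independent of [m]. *)
  move=> le_kg m; exists (psize lam + psize (a_seq g w k))%N => B le_B.
  by rewrite (@evx_dts_tau_part _ _ _ _ _ _ _ k (g - k)) // subnKC.
move=> lt_kg m le_m; exists (psize lam) => B le_B.
exact: evx_tauk_part_last.
Qed.
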